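(* Let $(\Omega,\mathcal F,\mathbb P)$ carry a finite-dimensional Brownian motion $B$ with first coordinate $B^1$ on the finite horizon $[0,T]$, and let $\mathbb F^B=(\mathcal F^B_t)_{0\le t\le T}$ be the usual augmentation of its natural filtration. Let $Z=\operatorname{sgn}(B^1_T-B^1_{T/2})$, which is $\mathcal F^B_T$-measurable. Let $\varepsilon_1,\varepsilon_2$ be independent Rademacher random variables such that $(\varepsilon_1,\varepsilon_2)$ is independent of $\mathcal F^B_T$, and set $\varepsilon_3=\varepsilon_1\varepsilon_2Z$. Then: (i) for every proper subset $I\subsetneq\{1,2,3\}$, the $\sigma$-field $\sigma(\varepsilon_i:i\in I)$ is independent of $\mathcal F^B_T$, so the initial enlargement of $\mathbb F^B$ by $\sigma(\varepsilon_i:i\in I)$ preserves immersion, i.e. $\mathbb F^B$ is immersed in it; (ii) $\varepsilon_1\varepsilon_2\varepsilon_3=Z$ almost surely, a nontrivial function of the future increment $B^1_T-B^1_{T/2}$, so the initial enlargement of $\mathbb F^B$ by $\sigma(\varepsilon_1,\varepsilon_2,\varepsilon_3)$ destroys immersion, i.e. $\mathbb F^B$ is not immersed in it. Hence the singletons and pairs of signals are non-anticipative (their initial enlargements preserve immersion) while the triple is anticipative (its initial enlargement does not): non-anticipativity fails to aggregate, with the failure first occurring at order three.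
   Context: A Rademacher variable takes values $+1$ and $-1$ with probability $1/2$ each. $\operatorname{sgn}$ is the sign function (its value at $0$ is irrelevant, as $\{B^1_T=B^1_{T/2}\}$ is a null set). All filtrations satisfy the usual conditions; equalities of $\sigma$-fields are up to $\mathbb P$-null sets. The initial enlargement of $\mathbb F^B$ by a $\sigma$-field $\mathcal H$ is the usual augmentation of $(\mathcal F^B_t\vee\mathcal H)_{0\le t\le T}$. For $\mathbb F^B\subseteq\mathbb G$, $\mathbb F^B$ is immersed in $\mathbb G$ if every $(\mathbb P,\mathbb F^B)$-local martingale is a $(\mathbb P,\mathbb G)$-local martingale (equivalently, $B$ remains a $(\mathbb P,\mathbb G)$-Brownian motion). A collection of signals is called non-anticipative (with respect to $\mathbb F^B$) if the initial enlargement of $\mathbb F^B$ by it preserves immersion, and anticipative otherwise. *)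

(* Defs.v *)
From HB Require Import structures.
From mathcomp Require Import all_boot all_order all_algebra.
From mathcomp Require Import all_classical all_reals all_analysis.

Set Implicit Arguments.
Unset Strict Implicit.
Unset Printing Implicit Defensive.

Import Order.TTheory GRing.Theory Num.Theory.
Import numFieldNormedType.Exports.

Local Open Scope classical_set_scope.
Local Open Scope ring_scope.

(* Sigma-fields on Omega are given as sets of events; a filtration on [0, T]
   is a map R -> set (set Omega) of which only the values at times in [0, T]
   matter. The same holds for processes X : R -> Omega -> R. *)

Section sigma_fields.
Context {d : measure_display} {Omega : measurableType d} {R : realType}.
Variable P : probability Omega R.

Definition sigma_rv {d'} {E : measurableType d'} (X : Omega -> E) :
    set (set Omega) :=
  preimage_set_system setT X measurable.

Definition sigma_family {I : Type} (D : set I) (X : I -> Omega -> R) :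
    set (set Omega) :=
  <<s \bigcup_(i in D) sigma_rv (X i) >>.

Definition independent (G H : set (set Omega)) :=
  forall A C, G A -> H C -> P (A `&` C) = (P A * P C)%E.

(* On a complete probability space these are all the negligible sets. *)
Definition null_events : set (set Omega) :=
  [set A | measurable A /\ P A = 0%E].

(* Right-continuous regularization of the null-set completion of K. For
   t < T the intersection ranges over the times in ]t, T]; at t = T it is the
   completion of K T. *)
Definition usual_augmentation (T : R) (K : R -> set (set Omega)) (t : R) :
    set (set Omega) :=
  \bigcap_(u in [set u | t < u]) <<s K (Num.min u T) `|` null_events >>.

Definition initial_enlargement (T : R) (F : R -> set (set Omega))
    (H : set (set Omega)) : R -> set (set Omega) :=
  usual_augmentation T (fun t => <<s F t `|` H >>).

Lemma usual_augmentation_mono T K s t : s <= t ->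
  usual_augmentation T K s `<=` usual_augmentation T K t.
Proof. by move=> st A KA u /= tu; apply: KA; exact: le_lt_trans tu. Qed.

Lemma sub_initial_enlargement T F H t : t <= T ->
  (forall u v, u <= v -> F u `<=` F v) ->
  F t `<=` initial_enlargement T F H t.
Proof.
move=> tT Fmono A FA u /= tu; apply: sub_sigma_algebra; left.
apply: sub_sigma_algebra; left; apply: Fmono FA.
by rewrite le_min tT (ltW tu).
Qed.

End sigma_fields.

Section martingales.
Context {d : measure_display} {Omega : measurableType d} {R : realType}.
Variables (P : probability Omega R) (T : R).

Definition adapted (F : R -> set (set Omega)) (M : R -> Omega -> R) :=
  forall t : R, 0 <= t <= T -> sigma_rv (M t) `<=` F t.

(* Y is a version of E[X | G] *)
Definition is_cond_exp (X : Omega -> R) (G : set (set Omega))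
    (Y : Omega -> R) :=
  [/\ sigma_rv Y `<=` G,
      P.-integrable setT (EFin \o Y) &
      forall A, G A ->
        (\int[P]_(w in A) (Y w)%:E = \int[P]_(w in A) (X w)%:E)%E].

Definition martingale (F : R -> set (set Omega)) (M : R -> Omega -> R) :=
  [/\ adapted F M,
      forall t : R, 0 <= t <= T -> P.-integrable setT (EFin \o M t) &
      forall s t : R, 0 <= s -> s <= t -> t <= T ->
        is_cond_exp (M t) (F s) (M s)].

Definition stopping_time (F : R -> set (set Omega)) (tau : Omega -> \bar R) :=
  (forall w, (0 <= tau w)%E) /\
  (forall t : R, 0 <= t <= T -> F t [set w | (tau w <= t%:E)%E]).

(* [fine] is harmless here: min(t, tau) is finite when tau >= 0. *)
Definition stopped (M : R -> Omega -> R) (tau : Omega -> \bar R)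
    (t : R) (w : Omega) : R :=
  M (fine (Order.min t%:E (tau w))) w.

Definition cadlag (f : R -> R) :=
  (forall t : R, 0 <= t < T -> f x @[x --> t^'+] --> f t) /\
  (forall t : R, 0 < t <= T -> cvg (f x @[x --> t^'-])).

(* On the closed horizon [0, T] a localizing sequence has to reach T in
   finitely many steps almost surely. *)
Definition localizing_sequence (F : R -> set (set Omega))
    (tau : nat -> Omega -> \bar R) :=
  [/\ forall k, stopping_time F (tau k),
      {ae P, forall w, forall k, (tau k w <= tau k.+1 w)%E} &
      {ae P, forall w, exists k, (T%:E <= tau k w)%E}].

Definition local_martingale (F : R -> set (set Omega))
    (M : R -> Omega -> R) :=
  [/\ adapted F M,
      {ae P, forall w, cadlag (M ^~ w)} &
      exists2 tau, localizing_sequence F tau &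
        forall k, martingale F (fun t w => stopped M (tau k) t w - M 0 w)].

(* For filtrations with F t `<=` G t on [0, T]. *)
Definition immersed (F G : R -> set (set Omega)) :=
  forall M, local_martingale F M -> local_martingale G M.

End martingales.

Section brownian.
Context {d : measure_display} {Omega : measurableType d} {R : realType}.
Variables (P : probability Omega R) (T : R) (m : nat).
Implicit Type B : 'I_m -> R -> Omega -> R.

Definition natural_filtration B (t : R) : set (set Omega) :=
  sigma_family (setT `*` `[0, t]) (fun p : 'I_m * R => B p.1 p.2).

(* Standard m-dimensional Brownian motion on [0, T]: the last two clauses say
   that B_t - B_s has law N(0, (t - s) Id) and is independent of the past up
   to s. *)
Definition brownian_motion B :=
  [/\ forall i (t : R), 0 <= t <= T -> measurable_fun setT (B i t),
      {ae P, forall w, forall i, B i 0 w = 0},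
      {ae P, forall w, forall i, {within `[0, T], continuous (B i ^~ w)}},
      forall s t : R, 0 <= s -> s < t -> t <= T ->
        forall U : 'I_m -> set R, (forall i, measurable (U i)) ->
          P (\bigcap_(i in setT) [set w | U i (B i t w - B i s w)]) =
          (\prod_(i < m) normal_prob 0 (Num.sqrt (t - s)) (U i))%E &
      forall s t : R, 0 <= s -> s < t -> t <= T ->
        independent P (sigma_family setT (fun i w => B i t w - B i s w))
          (natural_filtration B s)].

Definition brownian_filtration B : R -> set (set Omega) :=
  usual_augmentation P T (natural_filtration B).

Definition non_anticipative B (H : set (set Omega)) :=
  immersed P T (brownian_filtration B)
    (initial_enlargement P T (brownian_filtration B) H).

Definition anticipative B (H : set (set Omega)) := ~ non_anticipative B H.

End brownian.

Section signals.
Context {d : measure_display} {Omega : measurableType d} {R : realType}.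

Definition rademacher (P : probability Omega R) (X : Omega -> R) :=
  P (X @^-1` [set 1]) = (2^-1)%:E /\ P (X @^-1` [set -1]) = (2^-1)%:E.

Definition future_sign (T : R) (n : nat) (B : 'I_n.+1 -> R -> Omega -> R)
    (w : Omega) : R :=
  Num.sg (B ord0 T w - B ord0 (T / 2) w).

(* The signals (e1, e2, e1 * e2 * Z), indexed from 0. *)
Definition signals (e1 e2 Z : Omega -> R) (i : 'I_3) (w : Omega) : R :=
  [:: e1 w; e2 w; e1 w * e2 w * Z w]`_i.

Definition sigma_signals (e1 e2 Z : Omega -> R) (I : set 'I_3) :
    set (set Omega) :=
  sigma_family I (signals e1 e2 Z).

End signals.

(* Main.v *)
(* Two of the three signals cut Omega into four cells of probability 1/4, each
   independent of F_T. An event of the enlarged filtration at time s agrees on a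
   cell with an event of F_T that is unique up to null sets; the latter lies in
   F_u for all u > s, hence in F_s. So the integral of an F-martingale over an
   event of the enlargement is a combination of its integrals over events of F_s.

   The three signals reveal Z = sgn X, with X = B^1_T - B^1_{T/2}, at time 0. The
   bounded F-martingale M_t = E[min(X^+, 1) | F_t] starts from a constant c > 0
   and ends at 0 on {Z <> 1}; being bounded, it would be a true martingale of the
   enlargement if it were a local one. Averaging over an independent copy of the
   Brownian path makes M continuous without any Gaussian computation. *)

Require Import Defs.
From HB Require Import structures.
From mathcomp Require Import all_boot all_order all_algebra.
From mathcomp Require Import all_classical all_reals all_analysis.
From mathcomp Require Import measurable_realfun ring lra.

Set Implicit Arguments.
Unset Strict Implicit.
Unset Printing Implicit Defensive.

Import Order.TTheory GRing.Theory Num.Theory.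
Import numFieldNormedType.Exports.

Local Open Scope classical_set_scope.
Local Open Scope ring_scope.

(** No conditional expectation is ever constructed: each martingale identity is checked as an
    equality of integrals over events. For the pairs, the obstacle is right-continuity. The
    enlargement at time s is an intersection over u > s, each u yields its own trace event on a
    cell, and these must be merged into one. Independence from all of [F T], not merely from the
    past, makes traces unique up to null sets and so allows the merging. Signals may take stray
    values on null sets, hence cells are only required to have total mass one, not to cover [Omega].

    For the triple, E[Z | F_t] is the obvious witness, but sgn jumps at 0 and path continuity would
    need control of the mass near the jump. A bounded continuous function of X gets continuity from
    dominated convergence alone, up to and including T; it must also vanish for X <= 0 and have
    positive mean. The same continuity carries the martingale identity from natural events at times
    u > s down to the right-continuous F_s. *)

Section integral_on_events.
Context {d : measure_display} {Omega : measurableType d} {R : realType}.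
Variable P : probability Omega R.

Lemma integral_mrestr (D : set Omega) (mD : measurable D) (f : Omega -> \bar R) :
  measurable_fun setT f ->
  (\int[mrestr P mD]_w f w = \int[P]_(w in D) f w)%E.
Proof.
move=> mf; rewrite -(setvU D) setUC integral_setU//; first last.
- by apply/eqP; exact: setICr.
- exact: measurable_funTS.
- exact: measurableC.
rewrite [X in (_ + X)%E](@null_set_integral _ _ _ _ (~` D))//; first last.
- by rewrite /= /mrestr setICl measure0.
- exact: measurable_funTS.
- exact: measurableC.
rewrite adde0; apply: eq_measure_integral => A mA AD.
by rewrite /= /mrestr setIidl.
Qed.

(* Both sides are integrals of the identity against the law of f. *)
Lemma ge0_integral_law_scale (D C : set Omega) (mD : measurable D)
    (mC : measurable C) (k : {nonneg R}) (f : Omega -> \bar R) :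
  measurable_fun setT f -> (forall w, (0 <= f w)%E) ->
  (forall U, measurable U ->
    P (f @^-1` U `&` D) = ((k%:num)%:E * P (f @^-1` U `&` C))%E) ->
  (\int[P]_(w in D) f w = (k%:num)%:E * \int[P]_(w in C) f w)%E.
Proof.
move=> mf f0 fDC.
have law (E : set Omega) (mE : measurable E) : (\int[P]_(w in E) f w =
    \int[pushforward (mrestr P mE) f]_(y in [set y | (0 <= y)%E]) y)%E.
  rewrite ge0_integral_pushforward//.
  - rewrite -integral_mrestr//; apply: congr2 => //.
    by apply/seteqP; split=> // w _; exact: f0.
  - by rewrite -[X in measurable X]setTI; exact: emeasurable_fun_c_infty.
  - by move=> y; rewrite inE.
have m0 : measurable [set y : \bar R | (0 <= y)%E].
  by rewrite -[X in measurable X]setTI; exact: emeasurable_fun_c_infty.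
rewrite law (law _ mC) -ge0_integral_mscale//.
apply: eq_measure_integral => U mU _.
by rewrite /= /mscale /= /pushforward /mrestr fDC.
Qed.

(** With D = C intersected with an independent cell and k the mass of that cell, this is
    E[f; C and cell] = P(cell) E[f; C]. Splitting f into positive and negative parts reduces it to
    the nonnegative case. *)
Lemma integral_law_scale (D C : set Omega) (mD : measurable D)
    (mC : measurable C) (k : {nonneg R}) (f : Omega -> R) :
  P.-integrable setT (EFin \o f) ->
  (forall U, measurable U ->
    P (f @^-1` U `&` D) = ((k%:num)%:E * P (f @^-1` U `&` C))%E) ->
  (\int[P]_(w in D) (f w)%:E = (k%:num)%:E * \int[P]_(w in C) (f w)%:E)%E.
Proof.
move=> intf fDC.
have mf : measurable_fun setT (EFin \o f) by case/integrableP: intf.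
have lawE (g : \bar R -> \bar R) : measurable_fun setT g -> forall U, measurable U ->
    P ((g \o (EFin \o f)) @^-1` U `&` D) =
    ((k%:num)%:E * P ((g \o (EFin \o f)) @^-1` U `&` C))%E.
  move=> mg U mU; apply: (fDC ((g \o EFin) @^-1` U)).
  have mgE : measurable_fun [set: R] (g \o EFin).
    by apply: measurableT_comp => //; exact: EFin_measurable.
  by rewrite -[X in measurable X]setTI; exact: mgE.
have lawp := lawE _ (measurable_funepos (@measurable_id _ (\bar R) setT)).
have lawn := lawE _ (measurable_funeneg (@measurable_id _ (\bar R) setT)).
rewrite -funepos_comp in lawp; rewrite -funeneg_comp in lawn.
have intC : P.-integrable C (EFin \o f) by apply: integrableS intf.
rewrite [LHS]integralE [in RHS]integralE/=.
rewrite (@ge0_integral_law_scale D C mD mC k (EFin \o f)^\+%E)//; last first.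
  exact: measurable_funepos.
rewrite (@ge0_integral_law_scale D C mD mC k (EFin \o f)^\-%E)//; last first.
  exact: measurable_funeneg.
rewrite [RHS]muleBr//; apply: fin_num_adde_defr.
exact: integrable_pos_fin_num.
Qed.

Variables (J : finType) (E : J -> set Omega).
Hypotheses (mE : forall j, measurable (E j)) (tE : trivIset setT E).
Hypothesis PE : (\sum_j P (E j) = 1)%E.

Lemma integral_cells (A : set Omega) (f : Omega -> R) : measurable A ->
  P.-integrable setT (EFin \o f) ->
  (\int[P]_(w in A) (f w)%:E = \sum_j \int[P]_(w in A `&` E j) (f w)%:E)%E.
Proof.
move=> mA intf; pose U := \big[setU/set0]_j E j.
have mU : measurable U by apply: bigsetU_measurable.
have PU : P U = 1%E.
  (* Finite additivity of P over the cells is read off from additivity of the integral of the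
     constant 1. *)
  rewrite -[LHS]mul1e -(@integral_cst _ _ _ P _ mU).
  rewrite (@integral_bigsetU_EFin _ _ _ _ _ _ (cst 1))//; last 3 first.
  - exact: index_enum_uniq.
  - exact: sub_trivIset tE.
  - by apply: (measurable_funTS); exact: (measurable_cst (1%:E : \bar R)).
  transitivity (\sum_j P (E j))%E => //; apply: eq_bigr => j _.
  by rewrite (@integral_cst _ _ _ P _ (mE j) 1%E) mul1e.
have PNU : P (~` U) = 0%E by rewrite probability_setC// PU subee.
rewrite (@negligible_integral _ _ _ _ _ (~` U))//; first last.
- by apply: integrableS intf.
- exact: measurableC.
rewrite setDE setCK /U big_distrr/= integral_bigsetU_EFin//.
- by move=> j; exact: measurableI.
- exact: index_enum_uniq.
- by apply: trivIset_setIl; apply: sub_trivIset tE.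
- apply: measurable_funTS; by case/integrableP: intf.
Qed.

Lemma probability_cells (A : set Omega) : measurable A ->
  (P A = \sum_j P (A `&` E j))%E.
Proof.
move=> mA; rewrite -[LHS]mul1e -(@integral_cst _ _ _ P _ mA).
rewrite (integral_cells (f := cst 1)) //; last exact: finite_measure_integrable_cst.
apply: eq_bigr => j _.
by rewrite (@integral_cst _ _ _ P _ (measurableI _ _ mA (mE j)) 1%E) mul1e.
Qed.

End integral_on_events.

Lemma sigma_algebraU T (G : set (set T)) A B : sigma_algebra setT G ->
  G A -> G B -> G (A `|` B).
Proof.
move=> [G0 _ GU] GA GB; rewrite -bigcup2E; apply: GU.
by move=> [|[|k]].
Qed.

Lemma sigma_algebraI T (G : set (set T)) A B : sigma_algebra setT G ->
  G A -> G B -> G (A `&` B).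
Proof.
move=> sG GA GB; have [_ GC _] := sG.
have -> : A `&` B = setT `\` ((setT `\` A) `|` (setT `\` B)).
  by rewrite !setTD setCU !setCK.
by apply: (GC); apply: sigma_algebraU => //; exact: GC.
Qed.

(** * Traces of enlarged sigma-fields on a cell *)

Section enlargement.
Context {d : measure_display} {Omega : measurableType d} {R : realType}.
Variable P : probability Omega R.

Lemma usual_augmentation_sigma_algebra T K t :
  sigma_algebra setT (usual_augmentation P T K t).
Proof.
by apply: sigma_algebra_bigcap => u _; exact: smallest_sigma_algebra.
Qed.

Lemma null_events_usual_augmentation T K t :
  null_events P `<=` usual_augmentation P T K t.
Proof. by move=> N PN u _; apply: sub_sigma_algebra; right. Qed.

Lemma usual_augmentation_measurable T (K : R -> set (set Omega)) t :
  (forall u, u <= T -> K u `<=` measurable) ->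
  usual_augmentation P T K t `<=` measurable.
Proof.
move=> mK A /(_ (t + 1)) /=; rewrite ltrDl ltr01 => /(_ isT).
apply: smallest_sub; first exact: sigma_algebra_measurable.
by move=> B [|[]//]; apply: mK; rewrite ge_min lexx orbT.
Qed.

Lemma sub_usual_augmentation T (K : R -> set (set Omega)) t : t <= T ->
  (forall u v, u <= v -> K u `<=` K v) -> K t `<=` usual_augmentation P T K t.
Proof.
move=> tT Kmono A KA u /= tu; apply: sub_sigma_algebra; left.
by apply: Kmono KA; rewrite le_min tT (ltW tu).
Qed.

(** The events with such a trace form a sigma-algebra (exceptional null sets are united countably).
    It contains the generators: a member of [F] is its own trace, a null event has trace [set0], and
    a member of [H] has trace [setT] or [set0] since it is all or nothing on [E]. *)
Lemma enlargement_trace (F H : set (set Omega)) (E : set Omega) :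
  sigma_algebra setT F ->
  (forall A, H A -> E `<=` A \/ A `&` E = set0) ->
  forall A, <<s <<s F `|` H >> `|` null_events P >> A ->
    exists2 a, F a & exists2 N, null_events P N &
      forall w, E w -> ~ N w -> (A w <-> a w).
Proof.
move=> sF EH; pose G := [set A | exists2 a, F a &
  exists2 N, null_events P N & forall w, E w -> ~ N w -> (A w <-> a w)].
have [F0 FC FU] := sF.
have null0 : null_events P set0 by split => //; rewrite measure0.
have sG : sigma_algebra setT G.
  split.
  - by exists set0 => //; exists set0.
  - move=> A [a Fa [N PN AaN]]; exists (setT `\` a); first exact: FC.
    exists N => // w Ew Nw; have := AaN w Ew Nw.
    by rewrite !setTD /setC /= => ->.
  - move=> A_ GA.
    have /choice[a Ha] : forall n, exists a, F a /\ exists2 N, null_events P N &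
        forall w, E w -> ~ N w -> (A_ n w <-> a w).
      by move=> n; have [a Fa ?] := GA n; exists a.
    have /choice[N HN] : forall n, exists N, null_events P N /\
        forall w, E w -> ~ N w -> (A_ n w <-> a n w).
      by move=> n; have [_ [N ? ?]] := Ha n; exists N.
    exists (\bigcup_n a n); first by apply: FU => n; have [] := Ha n.
    exists (\bigcup_n N n).
      have mN n : measurable (N n) by have [[]] := HN n.
      split; first exact: bigcupT_measurable.
      apply: measure_negligible; first exact: bigcupT_measurable.
      apply: negligible_bigcup => n; apply/negligibleP => //.
      by have [[]] := HN n.
    move=> w Ew Nw; split => -[n _ Hw]; exists n => //.
      by have [_ /(_ w Ew) H'] := HN n; apply/H' => // ?; apply: Nw; exists n.
    by have [_ /(_ w Ew) H'] := HN n; apply/H' => // ?; apply: Nw; exists n.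
apply: smallest_sub => //; rewrite subUset; split; last first.
  move=> N PN; exists set0 => //; exists N => // w _ Nw; split=> //.
apply: smallest_sub => //; rewrite subUset; split.
  by move=> A FA; exists A => //; exists set0.
move=> A /EH [EA|AE0].
  exists setT; first by rewrite -(setD0 setT); exact: FC.
  by exists set0 => // w /EA Aw _; split.
exists set0 => //; exists set0 => // w Ew _; split=> // Aw.
by have : (A `&` E) w by []; rewrite AE0.
Qed.

End enlargement.

(** * Immersion from a finite family of independent cells *)

Section immersion.
Context {d : measure_display} {Omega : measurableType d} {R : realType}.
Variables (P : probability Omega R) (T : R) (K : R -> set (set Omega)).
Hypothesis mK : forall u, u <= T -> K u `<=` measurable.

Local Notation F := (usual_augmentation P T K).

Variables (J : finType) (E : J -> set Omega).
Hypotheses (mE : forall j, measurable (E j)) (tE : trivIset setT E).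
Hypothesis PE : (\sum_j P (E j) = 1)%E.
Hypothesis indE : forall j C, F T C -> (P (E j `&` C) = P (E j) * P C)%E.

Variable H : set (set Omega).
Hypothesis mH : H `<=` measurable.
Hypothesis atomE : forall j A, H A -> E j `<=` A \/ A `&` E j = set0.

(** Up to a null set an event of [H] is the union of the cells it contains, and each cell factors
    with [C]. *)
Lemma independent_of_cells : independent P H (F T).
Proof.
move=> A C HA FC; have mA := mH HA.
have mC : measurable C by apply: usual_augmentation_measurable FC.
rewrite (probability_cells mE tE PE (measurableI _ _ mA mC)).
rewrite (probability_cells mE tE PE mA) ge0_sume_distrl//.
apply: eq_bigr => j _; have [EA|AE0] := atomE j HA.
  by rewrite (setIidr EA) -setIA (setIC C) setIA (setIidr EA) indE.
by rewrite AE0 measure0 mul0e setIAC AE0 set0I measure0.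
Qed.

(* An event of the enlargement agrees on a cell with an event of F T that is
   unique up to null sets, hence in F s for arbitrarily small future, hence in
   the right-continuous F s. *)
Lemma initial_enlargement_trace (s : R) (A : set Omega) (j : J) :
  s <= T -> initial_enlargement P T F H s A ->
  exists2 a, F s a & exists2 N, null_events P N &
    forall w, E j w -> ~ N w -> (A w <-> a w).
Proof.
move=> sT GA.
have FE u := usual_augmentation_sigma_algebra P T K u.
(* This holds for u > T as well, because [usual_augmentation] caps times at T. *)
have FT u : F u `<=` F T.
  have [uT|/ltW uT] := leP u T; first exact: usual_augmentation_mono.
  move=> C FC v /= Tv; have [uv|vu] := ltP u v; first exact: FC.
  have /= := FC (u + 1); rewrite ltrDl ltr01 => /(_ isT).
  by rewrite !min_r// ?(ltW Tv)// (le_trans uT)// lerDl.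
have trace u : s < u -> exists2 a, F (Num.min u T) a &
    exists2 N, null_events P N & forall w, E j w -> ~ N w -> (A w <-> a w).
  move=> su; apply: enlargement_trace (FE _) (atomE j) _ _.
  exact: GA.
have null0 : null_events P set0 by split => //; rewrite measure0.
(* A null cell serves as its own exceptional set, so any trace works there. *)
have [PEj0|PEj0] := eqVneq (P (E j)) 0%E.
  exists set0; first by case: (FE s).
  by exists (E j).
(* [T + 1] is merely a time after s, capped to T: the candidate is so far only known to lie in
   [F T]. *)
have [a + [N PN AaN]] := trace (T + 1) ltac:(by rewrite (le_lt_trans sT)// ltrDl).
rewrite min_r ?lerDl// => Fa; exists a; last by exists N.
have Fall u : s < u -> F (Num.min u T) a.
  move=> su; have [b Fb [M PM AbM]] := trace u su.
  have Fb' := FT _ _ Fb.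
  have ma : measurable a by apply: usual_augmentation_measurable Fa.
  have mb : measurable b by apply: usual_augmentation_measurable Fb'.
  (* Uniqueness of the trace: the difference is null on the cell and independent of the cell, so P(E
     j) P(c minus e) = 0 with P(E j) nonzero. *)
  have null_diff c e : F T c -> F T e -> measurable c -> measurable e ->
      (forall w, E j w -> ~ N w -> ~ M w -> (c w <-> e w)) ->
      null_events P (c `\` e).
    move=> Fc Fe mc me ce; split; first exact: measurableD.
    have Fce : F T (c `\` e).
      have [_ FC _] := FE T.
      by rewrite setDE -setTD; apply: (sigma_algebraI (FE T)) => //; exact: FC.
    have : P (E j `&` (c `\` e)) = 0%E.
      apply: measure_negligible; first by apply: measurableI => //; exact: measurableD.
      apply: (@negligibleS _ _ _ _ (N `|` M)).
        move=> w [Ew [cw ew]]; apply: contrapT => /= NM.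
        by apply: ew; apply/(ce w Ew) => // ?; apply: NM; [left|right].
      by apply: negligibleU; apply/negligibleP; [case: PN|case: PN|case: PM|case: PM].
    rewrite indE// => /eqP; rewrite mule_eq0 (negbTE PEj0)/= => /eqP//.
  have Nab : null_events P (a `\` b).
    apply: null_diff => // w Ew Nw Mw.
    by rewrite -(AaN w)// -(AbM w).
  have Nba : null_events P (b `\` a).
    apply: null_diff => // w Ew Nw Mw.
    by rewrite -(AaN w)// -(AbM w).
  (* [a] is [b] corrected by two null events, written with complements and unions only. *)
  have -> : a = setT `\` ((setT `\` (b `|` (a `\` b))) `|` (b `\` a)).
    apply/seteqP; split=> w; rewrite /setU /setD /mkset/=;
      have [?|?] := pselect (a w); have [?|?] := pselect (b w); tauto.
  have [_ FC _] := FE (Num.min u T).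
  have nF := @null_events_usual_augmentation _ _ _ P T K (Num.min u T).
  apply: (FC); apply: (sigma_algebraU (FE _)); last exact: nF.
  by apply: FC; apply: (sigma_algebraU (FE _)) => //; exact: nF.
move=> u /= su.
(* Membership in [F] at v only informs about times strictly after v, so v is chosen strictly between
   s and u. *)
have [v /andP[sv vu]] : exists v, s < v < u.
  by exists ((s + u) / 2); rewrite midf_lt//= midf_lt.
have /= := Fall v sv u; apply.
by rewrite gt_min vu.
Qed.

(** Adaptedness and the localizing sequence carry over because the enlargement contains F. Only the
    averaging identity over the new events needs the cells. *)
Lemma immersed_of_cells : immersed P T F (initial_enlargement P T F H).
Proof.
have FE u := usual_augmentation_sigma_algebra P T K u.
have FG t : t <= T -> F t `<=` initial_enlargement P T F H t.
  move=> tT; apply: sub_initial_enlargement => // u v uv.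
  exact: usual_augmentation_mono.
move=> M [adM cM [tau [st nd tT] mM]]; split => //.
  by move=> t /[dup] t0T /andP[_ tT']; apply: subset_trans (FG _ tT'); exact: adM.
exists tau.
  split => // k; have [st0 stF] := st k; split => // t /[dup] t0T /andP[_ tT'].
  by apply: (FG _ tT'); exact: stF.
move=> k; have [adN iN ceN] := mM k; set N := (X in adapted _ _ X) in adN iN ceN *.
split => //.
  by move=> t /[dup] t0T /andP[_ tT']; apply: subset_trans (FG _ tT'); exact: adN.
move=> s t s0 st' tT'; have sT := le_trans st' tT'.
have t0 := le_trans s0 st'.
have iNs : P.-integrable setT (EFin \o N s) by apply: iN; rewrite s0.
have iNt : P.-integrable setT (EFin \o N t) by apply: iN; rewrite t0.
split.
- by apply: subset_trans (FG _ sT); apply: adN; rewrite s0.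
- exact: iNs.
move=> A GA.
have mG : initial_enlargement P T F H s `<=` measurable.
  apply: usual_augmentation_measurable => u uT.
  apply: smallest_sub; first exact: sigma_algebra_measurable.
  rewrite subUset; split => //; exact: usual_augmentation_measurable.
have mA := mG _ GA.
rewrite (integral_cells mE tE PE mA iNs) (integral_cells mE tE PE mA iNt).
apply: eq_bigr => j _.
have [a Fa [Z [mZ PZ] AaZ]] := initial_enlargement_trace j sT GA.
have ma : measurable a by apply: usual_augmentation_measurable Fa.
(* The trace [a] depends on s and j but not on r, so the identity may be used at both r = s and r =
   t, reducing the claim to the F-martingale property on [a]. *)
have cell r : 0 <= r -> r <= T ->
    (\int[P]_(w in A `&` E j) (N r w)%:E = P (E j) * \int[P]_(w in a) (N r w)%:E)%E.
  move=> r0 rT.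
  have iNr : P.-integrable setT (EFin \o N r) by apply: iN; rewrite r0.
  have mAE := measurableI _ _ mA (mE j).
  have maE := measurableI _ _ ma (mE j).
  rewrite (@negligible_integral _ _ _ _ _ Z)//; last exact: integrableS iNr.
  have -> : A `&` E j `\` Z = a `&` E j `\` Z.
    by apply/seteqP; split=> w /= [[? ?] ?]; split=> //; split=> //; apply/AaZ.
  rewrite -(@negligible_integral _ _ _ _ _ Z)//; last exact: integrableS iNr.
  have Pfin : P (E j) = (fine (P (E j)))%:E by rewrite fineK// fin_num_measure.
  have k0 : 0 <= fine (P (E j)) by rewrite fine_ge0.
  rewrite Pfin (@integral_law_scale _ _ _ _ _ _ maE ma (NngNum k0))// => U mU /=.
  rewrite -Pfin (setIC a) setIA (setIC _ (E j)) -setIA indE//.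
  apply: (sigma_algebraI (FE T)).
    apply: (@usual_augmentation_mono _ _ _ P T K r T) => //.
    by apply: (adN r); rewrite ?r0//; exists U; rewrite ?setTI.
  exact: (@usual_augmentation_mono _ _ _ P T K s T).
have [_ _ ceNst] := ceN s t s0 st' tT'.
by rewrite !cell// ceNst.
Qed.

End immersion.

(** * Positivity of Gaussian probabilities and measurability for sub-sigma-fields *)

Section normal_prob_itv.
Context {R : realType}.
Implicit Types m s : R.

Lemma normal_pdf_gt0 m s x : s != 0 -> 0 < normal_pdf m s x.
Proof.
move=> s0; rewrite normal_pdfE//; apply: mulr_gt0; first exact: normal_peak_gt0.
exact: expR_gt0.
Qed.

Lemma normal_prob_set1 m s x : normal_prob m s [set x] = 0%E.
Proof. exact: integral_set1. Qed.

(** A vanishing integral forces the density to vanish almost everywhere on [A], but the density is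
    positive everywhere. *)
Lemma normal_prob_gt0 m s (A : set R) : s != 0 -> measurable A ->
  (0 < lebesgue_measure A)%E -> (0 < normal_prob m s A)%E.
Proof.
move=> s0 mA muA; rewrite lt0e measure_ge0 andbT; apply/eqP => nA0.
have mf : measurable_fun A (EFin \o normal_pdf m s).
  by apply: measurable_funTS; apply/measurable_EFinP; exact: measurable_normal_pdf.
have /(ae_eq_integral_abs lebesgue_measure mA mf)[N [mN N0 AN]] :
    (\int[lebesgue_measure]_(x in A) `|(EFin \o normal_pdf m s) x| = 0)%E.
  rewrite -nA0; apply: eq_integral => x _.
  by rewrite /= ger0_norm// normal_pdf_ge0.
have : (lebesgue_measure A <= lebesgue_measure N)%E.
  apply: le_measure; rewrite ?inE// => x Ax; apply: AN => /= /(_ Ax) [] /eqP.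
  by rewrite gt_eqF// normal_pdf_gt0.
by rewrite N0 leNgt muA.
Qed.

End normal_prob_itv.

Section sigma_rv_lemmas.
Context {d : measure_display} {Omega : measurableType d} {R : realType}.
Implicit Types (f g : Omega -> R) (G : set (set Omega)).

(** Viewing [G] as the sigma-field of a measurable type makes the general closure properties of
    measurable functions available for [G]-measurability. *)
Lemma sigma_rv_measurable_fun G f : sigma_algebra setT G -> sigma_rv f `<=` G ->
  measurable_fun [set: g_sigma_algebraType G] f.
Proof.
move=> sG fG _ U mU; rewrite measurable_g_measurableTypeE//.
by apply: fG; exists U.
Qed.

Lemma sigma_rvB G f g : sigma_algebra setT G ->
  sigma_rv f `<=` G -> sigma_rv g `<=` G -> sigma_rv (f \- g) `<=` G.
Proof.
move=> sG fG gG _ [U mU <-].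
have := measurable_funB (sigma_rv_measurable_fun sG fG)
  (sigma_rv_measurable_fun sG gG).
by move=> /(_ measurableT U mU); rewrite measurable_g_measurableTypeE.
Qed.

Lemma sigma_rv_comp (g : R -> R) f : measurable_fun setT g ->
  sigma_rv (g \o f) `<=` sigma_rv f.
Proof. exact: preimage_set_system_compS. Qed.

Lemma sigma_rv_cst G (c : R) : sigma_algebra setT G ->
  sigma_rv (cst c : Omega -> R) `<=` G.
Proof.
move=> [G0 GC _] _ [U mU <-]; rewrite setTI.
have [cU|cU] := pselect (U c).
  have -> : cst c @^-1` U = setT `\` (set0 : set Omega).
    by rewrite setD0; apply/seteqP; split.
  exact: GC.
by have -> : cst c @^-1` U = (set0 : set Omega) by apply/seteqP; split.
Qed.

Lemma measurable_fun_sigma_rv f : measurable_fun setT f ->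
  sigma_rv f `<=` measurable.
Proof. by move=> mf _ [U mU <-]; exact: mf. Qed.

Lemma measurable_fun_sgr : measurable_fun [set: R] (@Num.sg R).
Proof.
have -> : @Num.sg R = \1_`]0, +oo[ \- \1_`]-oo, 0[.
  apply/funext => x; rewrite /= !indicE.
  case: sgrP => [->|x0|x0]; rewrite ?mem_setE ?in_itv/= ?ltxx ?andbT ?subrr//.
  - by rewrite x0 ltNge (ltW x0) subr0.
  - by rewrite x0 ltNge (ltW x0) sub0r.
by apply: measurable_funB; exact: measurable_indic.
Qed.

End sigma_rv_lemmas.

(** * The Brownian filtration and the law of the future increment *)

Section brownian_motion_lemmas.
Context {d : measure_display} {Omega : measurableType d} {R : realType}.
Variables (P : probability Omega R) (T : R) (T_gt0 : 0 < T).
Variables (n : nat) (B : 'I_n.+1 -> R -> Omega -> R).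
Hypothesis B_brownian : brownian_motion P T B.

Local Notation K := (natural_filtration B).
Local Notation F := (brownian_filtration P T B).
Local Notation X := (fun w => B ord0 T w - B ord0 (T / 2) w).
Local Notation Z := (future_sign T B).

Lemma half_ge0 : 0 <= T / 2. Proof. by rewrite divr_ge0// ltW. Qed.

Lemma half_lt : T / 2 < T.
Proof. by rewrite ltr_pdivrMr// ltr_pMr// ltr1n. Qed.

Lemma natural_filtration_mono u v : u <= v -> K u `<=` K v.
Proof.
move=> uv; apply: sub_sigma_algebra2 => A [[i t] [_ /= tu] At].
exists (i, t) => //; split=> //=; move: tu; rewrite !in_itv/= => /andP[-> tu].
exact: le_trans uv.
Qed.

Lemma natural_filtration_measurable u : u <= T -> K u `<=` measurable.
Proof.
move=> uT; apply: smallest_sub; first exact: sigma_algebra_measurable.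
move=> A [[i t] [_ /=]]; rewrite in_itv/= => /andP[t0 tu].
have [mB _ _ _ _] := B_brownian.
by apply: measurable_fun_sigma_rv; apply: mB; rewrite t0 (le_trans tu).
Qed.

Lemma sigma_rv_natural_filtration i t u : 0 <= t -> t <= u ->
  sigma_rv (B i t) `<=` K u.
Proof.
move=> t0 tu A BA; apply: sub_sigma_algebra; exists (i, t) => //.
by split=> //=; rewrite in_itv/= t0.
Qed.

Lemma sigma_rv_increment i s t u : 0 <= s -> 0 <= t -> s <= u -> t <= u ->
  sigma_rv (fun w => B i t w - B i s w) `<=` K u.
Proof.
move=> s0 t0 su tu; apply: sigma_rvB; first exact: smallest_sigma_algebra.
- exact: sigma_rv_natural_filtration.
- exact: sigma_rv_natural_filtration.
Qed.

Lemma measurable_increment i s t : 0 <= s <= T -> 0 <= t <= T ->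
  measurable_fun setT (fun w => B i t w - B i s w).
Proof.
have [mB _ _ _ _] := B_brownian => sT tT.
by apply: measurable_funB; exact: mB.
Qed.

Lemma increment_law i s t (U : set R) : 0 <= s -> s < t -> t <= T ->
  measurable U ->
  P [set w | U (B i t w - B i s w)] = normal_prob 0 (Num.sqrt (t - s)) U.
Proof.
move=> s0 st tT mU; have [_ _ _ lawB _] := B_brownian.
(* The other coordinates are left unconstrained and contribute factors 1. *)
pose V j := if j == i then U else setT.
have mV j : measurable (V j) by rewrite /V; case: ifP.
have := lawB s t s0 st tT V mV.
rewrite (bigD1 i)//= big1 ?mule1; last first.
  by move=> j /negbTE ji; rewrite /V ji probability_setT.
rewrite /V eqxx => <-; congr (P _); apply/seteqP; split=> w /=.
  by move=> Uw j _ /=; case: ifPn => // /eqP ->.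
by move=> /(_ i I) /=; rewrite eqxx.
Qed.

Lemma sqrt_half_neq0 : Num.sqrt (T - T / 2) != 0.
Proof. by rewrite gt_eqF// sqrtr_gt0 subr_gt0 half_lt. Qed.

Lemma measurable_future_increment : measurable_fun setT X.
Proof.
by apply: measurable_increment; rewrite ?half_ge0 ?(ltW half_lt)// lexx ltW.
Qed.

Lemma future_increment_neq0 : P [set w | X w = 0] = 0%E.
Proof.
have := @increment_law ord0 (T / 2) T [set 0] half_ge0 half_lt (lexx T).
by rewrite normal_prob_set1; apply; exact: measurable_set1.
Qed.

Lemma future_increment_gt0 : (0 < P [set w | (0 < X w)%R])%E.
Proof.
have := @increment_law ord0 (T / 2) T `]0, +oo[ half_ge0 half_lt (lexx T)
  (measurable_itv _).
under eq_set do rewrite /= in_itv/= andbT; move=> ->.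
apply: (normal_prob_gt0 _ sqrt_half_neq0 (measurable_itv _)).
by rewrite lebesgue_measure_itv/= ltry addye// ltry.
Qed.

Lemma future_increment_lt0 : (0 < P [set w | (X w < 0)%R])%E.
Proof.
have := @increment_law ord0 (T / 2) T `]-oo, 0[ half_ge0 half_lt (lexx T)
  (measurable_itv _).
under eq_set do rewrite /= in_itv/=; move=> ->.
apply: (normal_prob_gt0 _ sqrt_half_neq0 (measurable_itv _)).
by rewrite lebesgue_measure_itv/= ltNyr add0e ltry.
Qed.

Lemma brownian_filtration_measurable t : F t `<=` measurable.
Proof.
by apply: usual_augmentation_measurable; exact: natural_filtration_measurable.
Qed.

Lemma sigma_rv_future_sign : sigma_rv Z `<=` F T.
Proof.
apply: subset_trans (sub_usual_augmentation (lexx T) natural_filtration_mono).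
apply: (@subset_trans _ (sigma_rv X)).
  by apply: sigma_rv_comp; exact: measurable_fun_sgr.
by apply: sigma_rv_increment; rewrite ?half_ge0 ?(ltW half_lt)// ltW.
Qed.

Lemma future_sign_neq0 : P (Z @^-1` [set 0]) = 0%E.
Proof.
rewrite -[RHS]future_increment_neq0; congr (P _); apply/seteqP; split=> w /=.
  by move/eqP; rewrite sgr_eq0 => /eqP.
by move=> X0; rewrite /future_sign X0 sgr0.
Qed.

Lemma future_sign_not_cst : ~ (exists c : R, {ae P, forall w, Z w = c}).
Proof.
move=> [c [N [mN PN NZ]]].
have sub0 (A : set Omega) : measurable A -> (0 < P A)%E ->
    exists2 w, A w & Z w = c.
  move=> mA PA; apply: contrapT => nA.
  have : (P A <= P N)%E.
    apply: le_measure; rewrite ?inE// => w Aw; apply: NZ => /= Zc.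
    by apply: nA; exists w.
  by rewrite PN leNgt PA.
have mX (i : interval R) : measurable (X @^-1` [set` i]).
  have := measurable_future_increment measurableT (measurable_itv i).
  by rewrite setTI.
have [w1 + Z1] : exists2 w, (X @^-1` `]0, +oo[) w & Z w = c.
  apply: sub0 => //; have -> : X @^-1` `]0, +oo[ = [set w | 0 < X w];
    last exact: future_increment_gt0.
  by apply/seteqP; split=> w /=; rewrite in_itv/= andbT.
have [w2 + Z2] : exists2 w, (X @^-1` `]-oo, 0[) w & Z w = c.
  apply: sub0 => //; have -> : X @^-1` `]-oo, 0[ = [set w | X w < 0];
    last exact: future_increment_lt0.
  by apply/seteqP; split=> w /=; rewrite in_itv.
rewrite /= !in_itv/= andbT => X2 X1.
by move: Z1; rewrite -Z2 /future_sign gtr0_sg// ltr0_sg// => /eqP;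
  rewrite eq_sym lt_eqF// (lt_trans (ltrN10 R)) ?ltr01.
Qed.

End brownian_motion_lemmas.

(** * Finite combinatorics of the three signs *)

Section pairs_of_signals.
Context {d : measure_display} {Omega : measurableType d} {R : realType}.
Variables (P : probability Omega R) (FT : set (set Omega)).
Variables (e1 e2 : {RV P >-> R}) (Z : Omega -> R).
Hypotheses (e1_rademacher : rademacher P e1) (e2_rademacher : rademacher P e2).
Hypothesis e1_e2_independent : independent P (sigma_rv e1) (sigma_rv e2).
Hypothesis sFT : sigma_algebra setT FT.
Hypothesis mFT : FT `<=` measurable.
Hypothesis e12_independent : independent P (sigma_rv (fun w => (e1 w, e2 w))) FT.
Hypothesis ZFT : sigma_rv Z `<=` FT.
Hypothesis Z_sign : forall w, Z w \in [:: 0; 1; -1].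
Hypothesis Z_neq0 : P (Z @^-1` [set 0]) = 0%E.

Local Notation sgn b := ((-1) ^+ nat_of_bool b : R).
Local Notation eps := (signals e1 e2 Z).

Lemma sgn_inj (b c : bool) : sgn b = sgn c -> b = c.
Proof.
have N11 : (-1 == 1 :> R) = false by rewrite lt_eqF// (lt_trans (ltrN10 R)).
case: b c => -[]//; rewrite expr0 expr1 => /eqP; first by rewrite N11.
by rewrite eq_sym N11.
Qed.

Lemma measurable_preimage1 (f : Omega -> R) (c : R) : measurable_fun setT f ->
  measurable (f @^-1` [set c]).
Proof.
by move=> mf; rewrite -[X in measurable X]setTI; apply: mf.
Qed.

Lemma measurable_sign : measurable_fun setT Z.
Proof.
by move=> _ U mU; apply: mFT; apply: ZFT; exists U.
Qed.

Lemma sign_event (b : bool) : FT (Z @^-1` [set sgn b]).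
Proof. by apply: ZFT; exists [set sgn b]; rewrite ?setTI. Qed.

Lemma rademacher_sgn (e : {RV P >-> R}) (b : bool) : rademacher P e ->
  P (e @^-1` [set sgn b]) = (2^-1)%:E.
Proof. by move=> [p1 pN1]; case: b; rewrite ?expr0 ?expr1. Qed.

Lemma sum_Z_cells C : FT C ->
  (\sum_(z : bool) P (Z @^-1` [set sgn z] `&` C) = P C)%E.
Proof.
move=> FC; have mC := mFT FC.
have mZ b : measurable (Z @^-1` [set sgn b]) by exact: mFT (sign_event b).
have tZ : trivIset setT (fun b : bool => Z @^-1` [set sgn b]).
  by move=> b c _ _ [w [h1 h2]]; exact: sgn_inj (etrans (esym h1) h2).
(* The value 0 is the only one missed by the two signs, and it is taken on a null set. *)
have cover : Z @^-1` [set 0] = ~` (Z @^-1` [set sgn false] `|` Z @^-1` [set sgn true]).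
  apply/seteqP; split=> w /=.
    move=> ->; rewrite expr0 expr1 => -[] /eqP; first by rewrite eq_sym oner_eq0.
    by rewrite eq_sym oppr_eq0 oner_eq0.
  rewrite expr0 expr1 => /not_orP[Z1 ZN1].
  by have := Z_sign w; rewrite !inE => /or3P[] /eqP.
have PZ : (\sum_(b : bool) P (Z @^-1` [set sgn b]) = 1)%E.
  have mU : measurable (Z @^-1` [set sgn false] `|` Z @^-1` [set sgn true]).
    exact: measurableU.
  have disj : Z @^-1` [set sgn true] `&` Z @^-1` [set sgn false] = set0.
    by apply/seteqP; split=> // w [h1 h2]; have := sgn_inj (etrans (esym h1) h2).
  rewrite big_bool; apply: (etrans (esym (measureU P (mZ true) (mZ false) disj))).
  rewrite setUC -[X in _ = X]sube0 -Z_neq0 cover.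
  rewrite -probability_setC ?setCK//; exact: measurableC.
rewrite (probability_cells mZ tZ PZ mC).
by apply: eq_bigr => b _; rewrite setIC.
Qed.

Definition atom (q : bool * bool * bool) : set Omega :=
  [set w | [/\ e1 w = sgn q.1.1, e2 w = sgn q.1.2 & Z w = sgn q.2]].

(** The factor 1/4 is 1/2 for each free sign; the event on [Z] stays on the [FT] side, since [Z]
    itself is [FT]-measurable. *)
Lemma probability_atom q C : FT C ->
  P (atom q `&` C) = ((4^-1)%:E * P (Z @^-1` [set sgn q.2] `&` C))%E.
Proof.
move: q => [[x y] z] FC /=.
have -> : atom (x, y, z) `&` C = (fun w => (e1 w, e2 w)) @^-1`
    ([set sgn x] `*` [set sgn y]) `&` (Z @^-1` [set sgn z] `&` C).
  by apply/seteqP; split=> w [[]] //= h1 h2 [] //= h3 Cw.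
have e12z : sigma_rv (fun w => (e1 w, e2 w))
    ((fun w => (e1 w, e2 w)) @^-1` ([set sgn x] `*` [set sgn y])).
  exists ([set sgn x] `*` [set sgn y]); last by rewrite setTI.
  by apply: measurableX; exact: measurable_set1.
rewrite (e12_independent e12z (sigma_algebraI sFT (sign_event z) FC)).
congr (_ * _)%E.
have -> : (fun w => (e1 w, e2 w)) @^-1` ([set sgn x] `*` [set sgn y]) =
    e1 @^-1` [set sgn x] `&` e2 @^-1` [set sgn y] by [].
have mpre (e : {RV P >-> R}) b : sigma_rv e (e @^-1` [set sgn b]).
  by exists [set sgn b]; rewrite ?setTI.
rewrite (e1_e2_independent (mpre _ _) (mpre _ _)).
rewrite !rademacher_sgn// -EFinM -invfM; congr (_^-1%:E).
by rewrite -natrM.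
Qed.

Lemma measurable_atom q : measurable (atom q).
Proof.
have -> : atom q = e1 @^-1` [set sgn q.1.1] `&` e2 @^-1` [set sgn q.1.2] `&`
    Z @^-1` [set sgn q.2] by apply/seteqP; split=> w /= => [[]|[[]]].
apply: measurableI; last by apply: measurable_preimage1; exact: measurable_sign.
by apply: measurableI; apply: measurable_preimage1; exact: measurable_funPT.
Qed.

Lemma trivIset_atom : trivIset setT atom.
Proof.
move=> [[x y] z] [[x' y'] z'] _ _ [w [[h1 h2 h3] [h1' h2' h3']]].
have E1 : x = x' by exact: sgn_inj (etrans (esym h1) h1').
have E2 : y = y' by exact: sgn_inj (etrans (esym h2) h2').
have E3 : z = z' by exact: sgn_inj (etrans (esym h3) h3').
by rewrite E1 E2 E3.
Qed.

Lemma sum_atom (F : bool * bool * bool -> \bar R) :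
  (\sum_q F q = \sum_z \sum_x \sum_y F (x, y, z))%E.
Proof.
transitivity (\sum_q F (q.1.1, q.1.2, q.2))%E.
  by apply: eq_bigr => -[[]].
rewrite -(pair_bigA _ (fun p z => F (p.1, p.2, z)))/= exchange_big/=.
apply: eq_bigr => z _.
by rewrite -(pair_bigA _ (fun x y => F (x, y, z))).
Qed.

Lemma sum_probability_atom : (\sum_q P (atom q) = 1)%E.
Proof.
have [F0 FC _] := sFT.
have FTT : FT setT by rewrite -(setD0 setT); exact: FC.
rewrite sum_atom.
transitivity (\sum_(z : bool) P (Z @^-1` [set sgn z] `&` setT))%E; last first.
  by rewrite sum_Z_cells// probability_setT.
apply: eq_bigr => z _; rewrite !big_bool/=.
have PA x y : P (atom (x, y, z)) = ((4^-1)%:E * P (Z @^-1` [set sgn z]))%E.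
  by have := probability_atom (x, y, z) FTT; rewrite !setIT.
rewrite !PA setIT.
have -> : P (Z @^-1` [set sgn z]) = (fine (P (Z @^-1` [set sgn z])))%:E.
  by rewrite fineK// fin_num_measure//; apply: mFT; exact: sign_event.
by rewrite -!EFinM -!EFinD; congr EFin; field.
Qed.

Definition pair_cell (i j : 'I_3) (ab : bool * bool) : set Omega :=
  [set w | eps i w = sgn ab.1 /\ eps j w = sgn ab.2].

Lemma measurable_signals i : measurable_fun setT (eps i).
Proof.
have mZ := measurable_sign.
case: i => -[|[|[|//]]] ?; rewrite /signals /=; try exact: measurable_funPT.
by apply: measurable_funM => //; apply: measurable_funM.
Qed.

Lemma measurable_pair_cell i j ab : measurable (pair_cell i j ab).
Proof.
by apply: measurableI; apply: measurable_preimage1; exact: measurable_signals.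
Qed.

(** A bit b encodes the sign (-1)^b, so the product defining the third signal becomes an exclusive
    or. *)
Definition signal_bit (i : 'I_3) (x y z : bool) : bool :=
  nth false [:: x; y; x (+) y (+) z] i.

Lemma signals_atom i x y z w : atom (x, y, z) w ->
  eps i w = sgn (signal_bit i x y z).
Proof.
move=> [/= h1 h2 h3]; rewrite /signals /signal_bit h1 h2 h3.
case: i => -[|[|[|//]]] _ //=.
by rewrite -!signr_addb.
Qed.

(** Each value z contributes (1/4) P(Z = z, C) whatever [ab] is, so summing over z erases [Z].
    Fixing all three signs would instead determine z. *)
Lemma probability_pair_cell i j ab C : i != j -> FT C ->
  P (pair_cell i j ab `&` C) = ((4^-1)%:E * P C)%E.
Proof.
move=> ij FC; have mEC := measurableI _ _ (measurable_pair_cell i j ab) (mFT FC).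
rewrite (probability_cells measurable_atom trivIset_atom sum_probability_atom mEC).
pose hit x y z :=
  (signal_bit i x y z == ab.1) && (signal_bit j x y z == ab.2).
pose p z := ((4^-1)%:E * P (Z @^-1` [set sgn z] `&` C))%E.
have cellE x y z : P (pair_cell i j ab `&` C `&` atom (x, y, z)) =
    if hit x y z then p z else 0%E.
  rewrite /hit; case: andP => [[/eqP hi /eqP hj]|miss].
    rewrite -(probability_atom (x, y, z) FC : _ = p z); congr (P _).
    apply/seteqP; split=> w; first by case=> -[].
    move=> [aw Cw]; split=> //; split=> //; split.
      by rewrite (signals_atom i aw) hi.
    by rewrite (signals_atom j aw) hj.
  rewrite -(measure0 P); congr (P _); apply/seteqP; split=> // w [[[hi hj] _] aw].
  apply: miss; rewrite -(sgn_inj (etrans (esym hi) (signals_atom i aw))) eqxx.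
  by rewrite -(sgn_inj (etrans (esym hj) (signals_atom j aw))) eqxx.
rewrite sum_atom -(sum_Z_cells FC) ge0_sume_distrr//; apply: eq_bigr => z _.
rewrite -/(p z) !big_bool /= !cellE /hit /signal_bit.
(* Given z, exactly one choice of the two free signs produces the cell. *)
case: i ij {mEC cellE hit} => -[|[|[|//]]] ? ; case: j => -[|[|[|//]]] ? // _;
  by case: ab z => [[] []] [] /=; rewrite ?adde0 ?add0e.
Qed.


Lemma trivIset_pair_cell i j : trivIset setT (pair_cell i j).
Proof.
move=> [a b] [a' b'] _ _ [w [[h1 h2] [h1' h2']]].
have E1 : a = a' by exact: sgn_inj (etrans (esym h1) h1').
have E2 : b = b' by exact: sgn_inj (etrans (esym h2) h2').
by rewrite E1 E2.
Qed.

Lemma pair_cellE i j ab : i != j -> P (pair_cell i j ab) = (4^-1)%:E.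
Proof.
move=> ij; have [F0 FC _] := sFT.
have FTT : FT setT by rewrite -(setD0 setT); exact: FC.
have := probability_pair_cell ab ij FTT.
by rewrite setIT probability_setT mule1.
Qed.

Lemma sum_probability_pair_cell i j : i != j ->
  (\sum_ab P (pair_cell i j ab) = 1)%E.
Proof.
move=> ij; under eq_bigr do rewrite pair_cellE//.
rewrite sumEFin; congr EFin.
by rewrite sumr_const card_prod card_bool -(mulr_natl 4^-1) mulfV.
Qed.

Lemma pair_cell_independent i j ab C : i != j -> FT C ->
  P (pair_cell i j ab `&` C) = (P (pair_cell i j ab) * P C)%E.
Proof. by move=> ij FC; rewrite probability_pair_cell// pair_cellE. Qed.

Lemma sigma_signals_measurable I : sigma_signals e1 e2 Z I `<=` measurable.
Proof.
apply: smallest_sub; first exact: sigma_algebra_measurable.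
move=> A [i _]; apply: measurable_fun_sigma_rv; exact: measurable_signals.
Qed.

(** Every signal indexed by [I] is constant on the cell, and being all or nothing on a fixed set
    survives complements and countable unions. *)
Lemma pair_cell_atom i j ab (I : set 'I_3) A : I `<=` [set i; j] ->
  sigma_signals e1 e2 Z I A ->
  pair_cell i j ab `<=` A \/ A `&` pair_cell i j ab = set0.
Proof.
move=> Iij; pose E := pair_cell i j ab.
pose G := [set A | E `<=` A \/ A `&` E = set0].
have sG : sigma_algebra setT G.
  split.
  - by right; rewrite set0I.
  - move=> D [ED|DE]; [right|left].
      by apply/seteqP; split=> // w [[_ nD] /ED].
    by move=> w Ew; split=> // Dw; have : (D `&` E) w by []; rewrite DE.
  - move=> D GD; have [[k ED]|nED] := pselect (exists k, E `<=` D k).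
      by left=> w Ew; exists k => //; exact: ED.
    right; apply/seteqP; split=> // w [[k _ Dw] Ew].
    have [ED|DE] := GD k; first by apply: nED; exists k.
    by rewrite -DE.
suff : sigma_signals e1 e2 Z I `<=` G by exact.
apply: smallest_sub => // D [k /Iij kij [U _ <-]].
have [c Ec] : exists c, forall w, E w -> eps k w = c.
  case: kij => ->; first by exists (sgn ab.1) => w [].
  by exists (sgn ab.2) => w [].
have [Uc|nUc] := pselect (U c); [left|right].
  by move=> w Ew; split=> //=; rewrite Ec.
by apply/seteqP; split=> // w [[_ /=]] + Ew; rewrite Ec.
Qed.

End pairs_of_signals.

(** * Freezing one of two independent variables; truncations *)

Section freezing.
Context {d d1 d2 : measure_display} {Omega : measurableType d}
  {E1 : measurableType d1} {E2 : measurableType d2} {R : realType}.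
Variable P : probability Omega R.

(** Independence makes the joint law the product of the marginal laws; Tonelli then splits the
    integral, and both marginals are pulled back to [Omega], w' playing the independent copy. *)
Lemma independent_integral (U : Omega -> E1) (W : Omega -> E2)
    (g : E1 * E2 -> \bar R) :
  measurable_fun setT U -> measurable_fun setT W ->
  independent P (sigma_rv U) (sigma_rv W) ->
  measurable_fun setT g -> (forall z, (0 <= g z)%E) ->
  (\int[P]_w g (U w, W w) = \int[P]_w \int[P]_w' g (U w, W w'))%E.
Proof.
move=> mU mW indUW mg g0.
pose RU : {RV P >-> E1} := HB.pack U (isMeasurableFun.Build _ _ _ _ U mU).
pose RW : {RV P >-> E2} := HB.pack W (isMeasurableFun.Build _ _ _ _ W mW).
pose UW w := (U w, W w).
have mUW : measurable_fun setT UW by exact: measurable_fun_pair.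
pose RUW : {RV P >-> (E1 * E2)%type} :=
  HB.pack UW (isMeasurableFun.Build _ _ _ _ UW mUW).
have lawE (A : set E1) (C : set E2) : measurable A -> measurable C ->
    distribution P RUW (A `*` C) = (distribution P RU A * distribution P RW C)%E.
  move=> mA mC; apply: indUW.
    by exists A; rewrite ?setTI.
  by exists C; rewrite ?setTI.
transitivity (\int[distribution P RUW]_z g z)%E.
  by rewrite ge0_integral_distribution.
transitivity (\int[distribution P RU \x distribution P RW]_z g z)%E.
  apply: eq_measure_integral => D mD _.
  by apply/esym/product_measure_unique.
rewrite fubini_tonelli1// ge0_integral_distribution//; last 2 first.
- exact: measurable_fun_fubini_tonelli_F.
- by move=> x; apply: integral_ge0.
apply: eq_integral => w _; rewrite /= /fubini_F ge0_integral_distribution//.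
exact: measurableT_comp (measurable_pair1 _).
Qed.

End freezing.

Section truncation.
Context {R : realType}.

Definition unit_clip (x : R) : R := Num.max 0 (Num.min x 1).

Lemma unit_clip_ge0 x : 0 <= unit_clip x.
Proof. by rewrite le_max lexx. Qed.

Lemma unit_clip_le1 x : unit_clip x <= 1.
Proof. by rewrite ge_max ler01 ge_min lexx orbT. Qed.

Lemma unit_clip_le0 x : x <= 0 -> unit_clip x = 0.
Proof. by move=> x0; rewrite /unit_clip max_l// ge_min x0. Qed.

Lemma unit_clip_gt0 x : 0 < x -> 0 < unit_clip x.
Proof. by move=> x0; rewrite lt_max lt_min x0 ltr01 orbT. Qed.

Lemma continuous_unit_clip : continuous unit_clip.
Proof.
suff : continuous ((fun=> 0 : R) \max (idfun \min (fun=> 1))) by exact.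
apply: max_fun_continuous; first by move=> ?; exact: cvg_cst.
by apply: min_fun_continuous => ?; [exact: cvg_id|exact: cvg_cst].
Qed.

Lemma measurable_unit_clip : measurable_fun setT unit_clip.
Proof. exact: continuous_measurable_fun continuous_unit_clip. Qed.

Definition clamp (a b t : R) : R := Num.max a (Num.min t b).

Lemma continuous_clamp a b : continuous (clamp a b).
Proof.
suff : continuous ((fun=> a : R) \max (idfun \min (fun=> b))) by exact.
apply: max_fun_continuous; first by move=> ?; exact: cvg_cst.
by apply: min_fun_continuous => ?; [exact: cvg_id|exact: cvg_cst].
Qed.

Lemma clamp_itv a b t : a <= b -> a <= clamp a b t <= b.
Proof. by move=> ab; rewrite le_max lexx/= ge_max ab ge_min lexx orbT. Qed.

Lemma clamp_id a b t : a <= t <= b -> clamp a b t = t.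
Proof. by move=> /andP[at_ tb]; rewrite /clamp (min_l tb) max_r. Qed.

Lemma clamp_le a b t : t <= a -> clamp a b t = a.
Proof. by move=> ta; rewrite /clamp max_l// ge_min ta. Qed.

End truncation.

Lemma integral_cst_probability {d} {Omega : measurableType d} {R : realType}
    (P : probability Omega R) (c : R) : (\int[P]_w c%:E = c%:E)%E.
Proof.
rewrite (integral_cst P measurableT c%:E) -[RHS]mule1.
by congr (_ * _)%E; exact: probability_setT.
Qed.

Lemma sigma_rv_pair {d} {Omega : measurableType d} {R : realType}
    (G : set (set Omega)) (f g : Omega -> R) : sigma_algebra setT G ->
  sigma_rv f `<=` G -> sigma_rv g `<=` G ->
  sigma_rv (fun w => (f w, g w)) `<=` G.
Proof.
move=> sG fG gG _ [U mU <-].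
have := measurable_fun_pair (sigma_rv_measurable_fun sG fG)
  (sigma_rv_measurable_fun sG gG).
by move=> /(_ measurableT U mU); rewrite measurable_g_measurableTypeE.
Qed.

Lemma sigma_rv_indic {d} {Omega : measurableType d} {R : realType}
    (G : set (set Omega)) (A : set Omega) : sigma_algebra setT G -> G A ->
  sigma_rv (\1_A : Omega -> R) `<=` G.
Proof.
move=> sG GA _ [U mU <-].
have mA : measurable (A : set (g_sigma_algebraType G)).
  by rewrite measurable_g_measurableTypeE.
have := @measurable_indic _ _ R setT _ mA measurableT U mU.
by rewrite measurable_g_measurableTypeE.
Qed.

(** * The continuous bounded martingale built from the future increment *)

Section clipped_increment_martingale.
Context {d : measure_display} {Omega : measurableType d} {R : realType}.
Variables (P : probability Omega R) (T : R) (T_gt0 : 0 < T).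
Variables (n : nat) (B : 'I_n.+1 -> R -> Omega -> R).
Hypothesis B_brownian : brownian_motion P T B.

Local Notation K := (natural_filtration B).
Local Notation F := (brownian_filtration P T B).
Local Notation X := (fun w => B ord0 T w - B ord0 (T / 2) w).
Local Notation cl := (clamp (T / 2) T).

(** Clamping time to [T/2, T] gives one formula for all t: up to T/2 the past part is 0 and the
    future part is all of X. It also keeps [B] from being read outside [0, T]. *)
Definition past_part (t : R) (w : Omega) : R := B ord0 (cl t) w - B ord0 (T / 2) w.
Definition future_part (t : R) (w : Omega) : R := B ord0 T w - B ord0 (cl t) w.

Definition clip_mean (t x : R) : R :=
  fine (\int[P]_w (unit_clip (x + future_part t w))%:E).

(* E[unit_clip X | F t]: the past part is frozen, the future part, which is
   independent of it, is averaged. *)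
Definition clip_mart (t : R) (w : Omega) : R := clip_mean t (past_part t w).

Lemma half_le : T / 2 <= T. Proof. exact/ltW/half_lt. Qed.

Lemma cl_itv t : T / 2 <= cl t <= T.
Proof. by rewrite clamp_itv// half_le. Qed.

Lemma cl_ge0 t : 0 <= cl t.
Proof. by have /andP[+ _] := cl_itv t; apply: le_trans; exact: half_ge0. Qed.

Lemma measurable_past_part t : measurable_fun setT (past_part t).
Proof.
have /andP[_ clT] := cl_itv t.
by apply: (measurable_increment B_brownian);
  rewrite ?cl_ge0 ?half_ge0 ?clT ?half_le.
Qed.

Lemma measurable_future_part t : measurable_fun setT (future_part t).
Proof.
have /andP[_ clT] := cl_itv t.
by apply: (measurable_increment B_brownian); rewrite ?cl_ge0 ?clT// ltW// lexx.
Qed.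

Lemma measurable_clip_shift t x :
  measurable_fun setT (fun w => (unit_clip (x + future_part t w))%:E).
Proof.
apply/measurable_EFinP; apply: measurableT_comp measurable_unit_clip _.
by apply: measurable_funD => //; exact: measurable_future_part.
Qed.

Lemma clip_meanE t x :
  ((clip_mean t x)%:E = \int[P]_w (unit_clip (x + future_part t w))%:E)%E.
Proof.
rewrite /clip_mean fineK// ge0_fin_numE; last first.
  by apply: integral_ge0 => w _; rewrite lee_fin unit_clip_ge0.
apply: (@le_lt_trans _ _ (\int[P]_w cst 1 w)%E).
  apply: ge0_le_integral => //.
  - by move=> w _; rewrite lee_fin unit_clip_ge0.
  - exact: measurable_clip_shift.
  - by move=> w _; rewrite lee_fin unit_clip_le1.
by rewrite (integral_cst_probability P 1) ltry.
Qed.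

Lemma clip_mean_ge0 t x : 0 <= clip_mean t x.
Proof.
rewrite -lee_fin clip_meanE; apply: integral_ge0 => w _.
by rewrite lee_fin unit_clip_ge0.
Qed.

Lemma clip_mean_le1 t x : clip_mean t x <= 1.
Proof.
rewrite -lee_fin clip_meanE.
apply: (@le_trans _ _ (\int[P]_w cst 1 w)%E).
  apply: ge0_le_integral => //.
  - by move=> w _; rewrite lee_fin unit_clip_ge0.
  - exact: measurable_clip_shift.
  - by move=> w _; rewrite lee_fin unit_clip_le1.
by rewrite (integral_cst_probability P 1).
Qed.

Lemma measurable_clip_mean t : measurable_fun setT (clip_mean t).
Proof.
pose g (z : R * Omega) := (unit_clip (z.1 + future_part t z.2))%:E.
have mg : measurable_fun setT g.
  apply/measurable_EFinP; apply: measurableT_comp measurable_unit_clip _.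
  apply: measurable_funD => //.
  exact: measurableT_comp (measurable_future_part t) _.
have := @measurable_fun_fubini_tonelli_F _ _ _ _ _ P g mg
  (fun z => unit_clip_ge0 _ : (0 <= g z)%E).
by move=> /(measurableT_comp (@fine_measurable R setT measurableT)).
Qed.

Lemma measurable_clip_mart t : measurable_fun setT (clip_mart t).
Proof.
exact: measurableT_comp (measurable_clip_mean t) (measurable_past_part t).
Qed.

Lemma clip_mart_bound t w : `|clip_mart t w| <= 1.
Proof. by rewrite ger0_norm ?clip_mean_ge0// clip_mean_le1. Qed.

Lemma integrable_bounded (f : Omega -> R) (D : set Omega) : measurable D ->
  measurable_fun setT f -> (forall w, `|f w| <= 1) ->
  P.-integrable D (EFin \o f).
Proof.
move=> mD mf f1; apply: (@le_integrable _ _ _ _ _ mD _ (cst 1%E)).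
- by apply: measurable_funTS; exact/measurable_EFinP.
- by move=> w _; rewrite /= normr1 lee_fin.
- exact: (finite_measure_integrable_cst P 1 mD).
Qed.

Lemma clip_mart0 t w : t <= T / 2 -> clip_mart t w = clip_mart 0 w.
Proof.
move=> tT; have h0 := half_ge0 T_gt0.
by rewrite /clip_mart /clip_mean /past_part /future_part !clamp_le.
Qed.

Lemma clip_mart_cst t : t <= T / 2 -> clip_mart t = cst (clip_mean 0 0).
Proof.
move=> tT; apply/funext => w; rewrite clip_mart0//.
by rewrite /clip_mart /past_part clamp_le ?subrr// half_ge0.
Qed.

Lemma clip_martT w : clip_mart T w = unit_clip (X w).
Proof.
have clT : cl T = T by rewrite clamp_id// half_le lexx.
apply: EFin_inj; rewrite clip_meanE /future_part /past_part clT.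
under eq_integral do rewrite subrr addr0.
by rewrite integral_cst_probability.
Qed.

Lemma clip_mart_adapted : adapted T F clip_mart.
Proof.
move=> t /andP[t0 tT].
have sF := usual_augmentation_sigma_algebra P T K t.
have [th|/ltW ht] := leP t (T / 2); first by rewrite clip_mart_cst//; exact: sigma_rv_cst.
apply: (@subset_trans _ (sigma_rv (past_part t))).
  by apply: sigma_rv_comp; exact: measurable_clip_mean.
apply: subset_trans (sub_usual_augmentation tT (@natural_filtration_mono _ _ _ _ B)).
rewrite /past_part clamp_id ?ht//.
by apply: sigma_rv_increment => //; exact: half_ge0.
Qed.

Definition good_path (w : Omega) : Prop := {within `[0, T], continuous (B ord0 ^~ w)}.

Lemma ae_good_path : {ae P, forall w, good_path w}.
Proof.
have [_ _ cB _ _] := B_brownian.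
by apply: filterS cB => w /(_ ord0).
Qed.

Lemma good_path_cvg w (u : R^nat) t : good_path w -> u k @[k --> \oo] --> t ->
  B ord0 (cl (u k)) w @[k --> \oo] --> B ord0 (cl t) w.
Proof.
move=> /subspace_continuousP Bw ut.
have itv s : `[0, T]%classic (cl s).
  by rewrite /= in_itv/= cl_ge0; case/andP: (cl_itv s).
have clu : cl (u k) @[k --> \oo] --> cl t.
  by apply: continuous_cvg => //; exact: continuous_clamp.
(* Continuity is only known within [0, T]; clamped times never leave that interval. *)
apply: (@cvg_comp _ _ _ (fun k => cl (u k)) (B ord0 ^~ w) _
  (within `[0, T] (nbhs (cl t)))); last exact: Bw.
move=> A wA.
have : \forall k \near \oo, `[0, T]%classic (cl (u k)) -> A (cl (u k)).
  exact: clu _ wA.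
by apply: filterS => k; apply; exact: itv.
Qed.

Lemma clip_mart_cvg w (u : R^nat) t : good_path w -> u k @[k --> \oo] --> t ->
  clip_mart (u k) w @[k --> \oo] --> clip_mart t w.
Proof.
move=> gw ut.
have Wc w' : good_path w' -> future_part (u k) w' @[k --> \oo] --> future_part t w'.
  by move=> gw'; apply: cvgB; [exact: cvg_cst|exact: good_path_cvg].
have Vc : past_part (u k) w @[k --> \oo] --> past_part t w.
  by apply: cvgB; [exact: good_path_cvg|exact: cvg_cst].
apply: fine_cvg; rewrite -[X in _ --> X]/(EFin (clip_mart t w)) clip_meanE.
(* The path w is fixed and the convergence runs over the independent copy w', almost every one of
   which is continuous. *)
have [] // := @dominated_convergence _ _ _ P setT measurableT
  (fun k w' => (unit_clip (past_part (u k) w + future_part (u k) w'))%:E)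
  (fun w' => (unit_clip (past_part t w + future_part t w'))%:E) (cst 1%E).
- by move=> k; exact: measurable_clip_shift.
- exact: measurable_clip_shift.
- apply: filterS ae_good_path => w' gw' _.
  apply: cvg_EFin; first by near=> k.
  apply: continuous_cvg; first exact: continuous_unit_clip.
  by apply: cvgD => //; exact: Wc.
- exact: finite_measure_integrable_cst.
- by apply: aeW => w' k _; rewrite /= ger0_norm ?unit_clip_ge0// lee_fin unit_clip_le1.
Unshelve. all: by end_near. Qed.

Lemma clip_mart_cadlag : {ae P, forall w, cadlag T (clip_mart ^~ w)}.
Proof.
apply: filterS ae_good_path => w gw; split => t _.
  by apply/cvg_at_rightP => u [_ ut]; exact: clip_mart_cvg.
apply/cvg_ex; exists (clip_mart t w).
by apply/cvg_at_leftP => u [_ ut]; exact: clip_mart_cvg.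
Qed.

Local Notation X_clip := (fun w => unit_clip (X w)).

Lemma measurable_X_clip : measurable_fun setT X_clip.
Proof.
apply: measurableT_comp measurable_unit_clip _.
exact: measurable_future_increment B_brownian.
Qed.

Lemma X_clip_bound w : `|unit_clip (X w)| <= 1.
Proof. by rewrite ger0_norm ?unit_clip_ge0// unit_clip_le1. Qed.

Lemma integral_clip_mart_natural u A : T / 2 <= u -> u <= T -> K u A ->
  (\int[P]_(w in A) (clip_mart u w)%:E = \int[P]_(w in A) (unit_clip (X w))%:E)%E.
Proof.
(* u = T is treated apart: independence of increments is assumed only for u < T, and at T the
   martingale already equals the clipped increment. *)
move=> hu; rewrite le_eqVlt => /predU1P[-> _|uT KA].
  by apply: eq_integral => w _; rewrite clip_martT.
have h0 := half_ge0 T_gt0.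
have u0 := le_trans h0 hu.
have clu : cl u = u by rewrite clamp_id// hu ltW.
have mA : measurable A by exact: natural_filtration_measurable B_brownian _ (ltW uT) _ KA.
(* The indicator of [A] is frozen together with the past part, so the freezing identity applies
   directly to an integral over [A]. *)
pose U w : R * R := (\1_A w, past_part u w).
(* The absolute value makes [g] nonnegative on the whole product space, as Tonelli requires; on an
   indicator it changes nothing. *)
pose g (z : (R * R) * R) : \bar R := (unit_clip (z.1.2 + z.2) * `|z.1.1|)%:E.
have mU : measurable_fun setT U.
  apply: measurable_fun_pair; first exact: measurable_indic.
  exact: measurable_past_part.
have KU : sigma_rv U `<=` K u.
  have sK : sigma_algebra setT (K u) by exact: smallest_sigma_algebra.
  apply: (sigma_rv_pair sK (sigma_rv_indic sK KA)).
  by rewrite /past_part clu; apply: sigma_rv_increment.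
have indUW : independent P (sigma_rv U) (sigma_rv (future_part u)).
  move=> D C UD WC.
  have [_ _ _ _ indB] := B_brownian.
  rewrite setIC muleC; apply: (indB u T) => //; last exact: KU.
  apply: sub_sigma_algebra; exists ord0 => //.
  by move: WC; rewrite /future_part clu.
have mg : measurable_fun setT g.
  apply/measurable_EFinP; apply: measurable_funM.
    apply: measurableT_comp measurable_unit_clip _; apply: measurable_funD => //.
    exact: measurableT_comp measurable_snd measurable_fst.
  apply: measurableT_comp => //.
  exact: measurableT_comp measurable_fst measurable_fst.
have g0 z : (0 <= g z)%E by rewrite lee_fin mulr_ge0// unit_clip_ge0.
have := independent_integral mU (measurable_future_part u) indUW mg g0.
rewrite /g/= => intE.
rewrite [LHS]integral_mkcond [RHS]integral_mkcond !epatch_indic.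
transitivity (\int[P]_w (unit_clip (past_part u w + future_part u w) * `|\1_A w|)%:E)%E.
  rewrite intE; apply: eq_integral => w _; rewrite /= clip_meanE.
  under [RHS]eq_integral do rewrite EFinM.
  rewrite ge0_integralZr//=.
  - by rewrite ger0_norm.
  - exact: measurable_clip_shift.
  - by move=> w' _; rewrite lee_fin unit_clip_ge0.
apply: eq_integral => w _; rewrite /= -EFinM ger0_norm//.
by rewrite /past_part /future_part addrC subrKA.
Qed.

End clipped_increment_martingale.

(** The trace argument with the single cell [setT] and no extra information: a completed event is a
    [K]-event up to a null set. *)
Lemma integral_null_completion {d} {Omega : measurableType d} {R : realType}
    (P : probability Omega R) (K : set (set Omega)) (A : set Omega) :
  sigma_algebra setT K -> K `<=` measurable -> <<s K `|` null_events P >> A ->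
  exists2 a, K a & forall f : Omega -> R, P.-integrable setT (EFin \o f) ->
    (\int[P]_(w in A) (f w)%:E = \int[P]_(w in a) (f w)%:E)%E.
Proof.
move=> sK mK KA.
have set0_atom : forall D : set Omega, set0 D -> setT `<=` D \/ D `&` setT = set0.
  by [].
have [|a Ka [N [mN PN] AaN]] := @enlargement_trace _ _ _ P K set0 setT sK set0_atom A.
  by rewrite setU0 (sigma_algebra_id sK).
have mA : measurable A.
  apply: smallest_sub KA; first exact: sigma_algebra_measurable.
  by rewrite subUset; split=> // ? [].
have ma := mK _ Ka.
exists a => // f intf.
rewrite [LHS](@negligible_integral _ _ _ _ _ N)//; last exact: integrableS intf.
rewrite [RHS](@negligible_integral _ _ _ _ _ N)//; last exact: integrableS intf.
by congr integral; apply/seteqP; split=> w [? ?]; split=> //; apply/AaN.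
Qed.

(** * Martingale property in the augmented filtration and failure of immersion *)

Section clipped_increment_local_martingale.
Context {d : measure_display} {Omega : measurableType d} {R : realType}.
Variables (P : probability Omega R) (T : R) (T_gt0 : 0 < T).
Variables (n : nat) (B : 'I_n.+1 -> R -> Omega -> R).
Hypothesis B_brownian : brownian_motion P T B.

Local Notation K := (natural_filtration B).
Local Notation F := (brownian_filtration P T B).
Local Notation X := (fun w => B ord0 T w - B ord0 (T / 2) w).
Local Notation cl := (clamp (T / 2) T).
Local Notation M := (clip_mart P T B).
Local Notation c := (clip_mean P T B 0 0).

Lemma integral_clip_mart s A : s <= T -> F s A ->
  (\int[P]_(w in A) (M s w)%:E = \int[P]_(w in A) (unit_clip (X w))%:E)%E.
Proof.
rewrite le_eqVlt => /predU1P[-> _|sT FA].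
  by apply: eq_integral => w _; rewrite clip_martT.
have /andP[hs sT'] : T / 2 <= cl s <= T by exact: cl_itv.
have s_cl : s <= cl s by rewrite le_max le_min lexx (ltW sT) orbT.
have clT : cl s < T by rewrite gt_max half_lt// gt_min sT.
have mA : measurable A by exact: brownian_filtration_measurable B_brownian _ _ FA.
(* An event of F_s is, up to null sets, a natural event at each time strictly after s. These times
   decrease to [cl s] and start at T, since [harmonic 0] is 1. *)
pose u k := cl s + (T - cl s) * harmonic k.
have su k : cl s < u k by rewrite ltrDl mulr_gt0// ?subr_gt0// harmonic_gt0.
have uT k : u k <= T.
  rewrite /u -lerBrDl ler_piMr ?subr_ge0// invf_le1 ?ltr0n//.
  by rewrite ler1n.
have ut : u k @[k --> \oo] --> cl s.
  rewrite -[X in _ --> X]addr0 -[X in _ --> _ + X](mulr0 (T - cl s)).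
  apply: cvgD; first exact: cvg_cst.
  by apply: cvgM; [exact: cvg_cst|exact: cvg_harmonic].
have iM t : P.-integrable setT (EFin \o M t).
  apply: integrable_bounded => //; first exact: measurable_clip_mart.
  exact: clip_mart_bound.
have iX : P.-integrable setT (EFin \o (fun w => unit_clip (X w))).
  apply: integrable_bounded => //; first exact: (measurable_X_clip T_gt0 B_brownian).
  exact: X_clip_bound.
have Eu k : (\int[P]_(w in A) (M (u k) w)%:E =
    \int[P]_(w in A) (unit_clip (X w))%:E)%E.
  have /= := FA (u k); rewrite (le_lt_trans s_cl)// => /(_ isT).
  rewrite min_l// => KA.
  have sK : sigma_algebra setT (K (u k)) by exact: smallest_sigma_algebra.
  have mK := natural_filtration_measurable B_brownian (uT k).
  have [a Ka EA] := integral_null_completion sK mK KA.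
  rewrite !EA//; apply: integral_clip_mart_natural => //.
  exact: le_trans hs (ltW (su k)).
have [] // := @dominated_convergence _ _ _ P A mA
  (fun k w => (M (u k) w)%:E) (fun w => (M (cl s) w)%:E) (cst 1%E).
- by move=> k; apply: measurable_funTS; apply/measurable_EFinP; exact: measurable_clip_mart.
- by apply: measurable_funTS; apply/measurable_EFinP; exact: measurable_clip_mart.
- apply: filterS (ae_good_path B_brownian) => w gw _.
  apply: cvg_EFin; first by near=> k.
  exact: clip_mart_cvg.
- exact: finite_measure_integrable_cst.
- by apply: aeW => w k _; rewrite /= lee_fin clip_mart_bound.
move=> _ _; under eq_fun do rewrite Eu.
(* Clamping is idempotent, so the limit at [cl s] is the value at s. *)
have -> : M (cl s) = M s.
  by rewrite /clip_mart /clip_mean /past_part /future_part clamp_id// hs.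
move=> Mcvg; apply: cvg_unique Mcvg _ => //; exact: cvg_cst.
Unshelve. all: by end_near. Qed.

Lemma clip_mart_centered_bound t w : `|M t w - c| <= 2.
Proof.
apply: le_trans (ler_normB _ _) _.
have := clip_mart_bound T_gt0 B_brownian t w.
have : `|c| <= 1 by rewrite ger0_norm ?clip_mean_ge0// clip_mean_le1.
lra.
Qed.

Lemma clip_mart_martingale :
  martingale P T F (fun t w => M t w - M 0 w).
Proof.
have M0 : M 0 = cst c by rewrite clip_mart_cst// half_ge0.
have iM t : P.-integrable setT (EFin \o (fun w => M t w - M 0 w)).
  rewrite M0; apply: (@le_integrable _ _ _ _ _ measurableT _ (cst 2%:E)).
  - apply/measurable_EFinP; apply: measurable_funB => //.
    exact: measurable_clip_mart.
  - move=> w _; rewrite /= lee_fin (le_trans (clip_mart_centered_bound t w))//.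
    exact: ler_norm.
  - exact: finite_measure_integrable_cst.
have adM : adapted T F (fun t w => M t w - M 0 w).
  move=> t tT; apply: sigma_rvB.
  - exact: usual_augmentation_sigma_algebra.
  - exact: clip_mart_adapted.
  - by rewrite M0; apply: sigma_rv_cst; exact: usual_augmentation_sigma_algebra.
split=> // s t s0 st tT; have sT := le_trans st tT; split=> //.
  by apply: adM; rewrite s0.
move=> A FA.
have mA : measurable A by exact: brownian_filtration_measurable B_brownian _ _ FA.
have E r : F r A -> r <= T -> (\int[P]_(w in A) (M r w - M 0 w)%:E =
    \int[P]_(w in A) (unit_clip (X w))%:E - \int[P]_(w in A) c%:E)%E.
  move=> FrA rT; rewrite -(integral_clip_mart rT FrA) M0.
  under eq_integral do rewrite EFinB.
  rewrite integralB_EFin//.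
    apply: integrable_bounded => //; first exact: measurable_clip_mart.
    exact: clip_mart_bound.
  exact: finite_measure_integrable_cst.
rewrite !E//; exact: (usual_augmentation_mono st).
Qed.

Lemma clip_mart_local_martingale : local_martingale P T F M.
Proof.
split.
- exact: clip_mart_adapted.
- exact: clip_mart_cadlag.
(* A true martingale needs no stopping: the infinite times localize. *)
exists (fun _ _ => +oo%E).
  split.
  - move=> k; split => [w|t _]; first exact: leey.
    have -> : [set w : Omega | (+oo <= t%:E)%E] = set0 by apply/seteqP; split.
    by have [] := usual_augmentation_sigma_algebra P T K t.
  - by apply: aeW => w k.
  - by apply: aeW => w; exists 0%N; rewrite leey.
move=> k; have := clip_mart_martingale; congr martingale.
by apply/funext => t; apply/funext => w; rewrite /stopped min_l// leey.
Qed.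

(** c is the mean of the clipped X; were it 0, the clipped X would vanish almost surely, against P(X
    > 0) > 0. *)
Lemma clip_mean_gt0 : 0 < c.
Proof.
rewrite lt_def (clip_mean_ge0 T_gt0 B_brownian) andbT; apply/eqP => c0.
have mX : measurable_fun setT (EFin \o (fun w => unit_clip (X w))).
  by apply/measurable_EFinP; exact: (measurable_X_clip T_gt0 B_brownian).
have : (\int[P]_(w in setT) `|(EFin \o (fun w => unit_clip (X w))) w| = 0)%E.
  rewrite -[RHS]/(0%:E) -c0 clip_meanE//; apply: eq_integral => w _.
  rewrite /= ger0_norm ?unit_clip_ge0// /future_part add0r clamp_le//.
  exact: half_ge0.
move=> /(ae_eq_integral_abs P measurableT mX)[N [mN PN XN]].
have := future_increment_gt0 T_gt0 B_brownian; apply/negP; rewrite -leNgt -PN.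
apply: le_measure; rewrite ?inE//.
  have := measurable_future_increment T_gt0 B_brownian measurableT
    (@measurable_itv R `]0, +oo[).
  by rewrite setTI; congr measurable; apply/seteqP; split=> w /=; rewrite in_itv/= andbT.
move=> w /= Xw; apply: XN => /= /(_ I) [] /eqP.
by rewrite gt_eqF// unit_clip_gt0.
Qed.

(* An initial enlargement that knows a non-null event on which X <= 0 breaks
   the martingale: there its terminal value is 0 but its initial one is c > 0. *)
Lemma not_immersed (G : R -> set (set Omega)) (A : set Omega) :
  measurable A -> G 0 A -> {ae P, forall w, A w -> X w <= 0} ->
  (0 < P A)%E -> ~ immersed P T F G.
Proof.
move=> mA GA AX PA imm.
have [_ _ [tau [tauS tau_nd tau_T] mN]] := imm _ clip_mart_local_martingale.
pose N k t w := stopped M (tau k) t w - M 0 w.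
have T0 : 0 <= T by exact: ltW.
have M0 : M 0 = cst c by rewrite clip_mart_cst// half_ge0.
have mNT k : measurable_fun setT (EFin \o N k T).
  have [_ iN _] := mN k.
  have : P.-integrable setT (EFin \o N k T) by apply: iN; rewrite T0 lexx.
  by case/integrableP.
have N0 k : (\int[P]_(w in A) (N k T w)%:E = 0)%E.
  have [_ _ ceN] := mN k; have [_ _ <-//] := ceN 0 T (lexx 0) T0 (lexx T).
  rewrite integral0_eq// => w _; rewrite /stopped min_l ?subrr//.
  by have [] := tauS k.
have [] // := @dominated_convergence _ _ _ P A mA
  (fun k w => (N k T w)%:E) (fun w => (M T w - c)%:E) (cst 2%:E).
- by move=> k; apply: measurable_funTS; exact: mNT.
- apply: measurable_funTS; apply/measurable_EFinP; apply: measurable_funB => //.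
  exact: measurable_clip_mart.
(* Once some [tau k0] reaches T, monotonicity keeps all later ones there, so the stopped values at T
   are eventually constant in k. The bound 2 holds at every stopped time, which removes the
   localization. *)
- apply: filterS2 tau_nd tau_T => w nd [k0 Tk0] _.
  apply: cvg_near_cst; exists k0 => // k /= k0k.
  rewrite /N /stopped M0 min_l//; apply: (le_trans Tk0).
  elim: k k0k => [|k IH]; first by rewrite leqn0 => /eqP ->.
  rewrite leq_eqVlt => /predU1P[->//|]; rewrite ltnS => /IH.
  by move=> /le_trans; apply.
- exact: finite_measure_integrable_cst.
- by apply: aeW => w k _; rewrite /= lee_fin /N M0 clip_mart_centered_bound.
move=> _ _; under eq_fun do rewrite N0.
move=> /(cvg_unique _ (cvg_cst 0%E)) => /(_ (@ereal_hausdorff R)) int0.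
(* On [A] the terminal value is 0, so the limit, already known to be 0, equals -c P(A), which is
   negative. *)
have : (\int[P]_(w in A) (M T w - c)%:E = (- c)%:E * P A)%E.
  rewrite -integral_cst//; apply: ae_eq_integral => //.
    apply: measurable_funTS; apply/measurable_EFinP; apply: measurable_funB => //.
    exact: measurable_clip_mart.
  apply: filterS AX => w AX Aw.
  by rewrite /= clip_martT// unit_clip_le0 ?AX// sub0r.
rewrite -int0 => /esym/eqP; rewrite mule_eq0 (gt_eqF PA) orbF eqe oppr_eq0.
by rewrite gt_eqF// clip_mean_gt0.
Qed.

End clipped_increment_local_martingale.

(** The two prescribed masses add up to 1, so any other value is taken on a null set only. *)
Lemma rademacher_ae {d} {Omega : measurableType d} {R : realType}
    (P : probability Omega R) (e : {RV P >-> R}) : rademacher P e ->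
  {ae P, forall w, e w ^+ 2 = 1}.
Proof.
move=> [p1 pN1]; pose A := e @^-1` [set 1]; pose C := e @^-1` [set -1].
have mA : measurable A by apply: measurable_preimage1; exact: measurable_funPT.
have mC : measurable C by apply: measurable_preimage1; exact: measurable_funPT.
have AC : A `&` C = set0.
  apply/seteqP; split=> // w [h1 hN1].
  have /eqP := etrans (esym h1) hN1 : 1 = -1 :> R.
  by rewrite eq_sym lt_eqF// (lt_trans (ltrN10 R)).
exists (~` (A `|` C)); split.
- by apply: measurableC; exact: measurableU.
- have PAC : P (A `|` C) = 1%E.
    apply: (etrans (measureU P mA mC AC)).
    transitivity ((2^-1)%:E + (2^-1)%:E : \bar R)%E; first by congr (_ + _)%E.
    by rewrite -EFinD; congr EFin; field.
  by rewrite probability_setC ?PAC ?subee//; exact: measurableU.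
- move=> w /= e2; apply: contra_not e2 => -[] /= ->; first by rewrite expr1n.
  by rewrite sqrrN expr1n.
Qed.

Lemma I3_proper_sub_pair (I : set 'I_3) : I `<` [set: 'I_3] ->
  exists i j, i != j /\ I `<=` [set i; j].
Proof.
move=> [_ nI]; have [k nIk] : exists k, ~ I k.
  by apply: contra_notP nI => /forallNP I_ k _; apply: contrapT.
pose o (m : nat) := inord m : 'I_3.
have oE m : (m < 3)%N -> nat_of_ord (o m) = m by exact: inordK.
(* The smallest and the largest of the two indices other than the missing k. *)
exists (if val k == 0%N then o 1%N else o 0%N), (if val k == 2%N then o 1%N else o 2%N).
split.
  by apply/eqP => /(congr1 val); case: ifP; case: ifP; rewrite /= !oE// => /eqP ->.
move=> l Il; have /eqP lk : l != k by apply/eqP => E; apply: nIk; rewrite -E.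
have {}lk : val l <> val k by move/val_inj.
have -> : l = o (val l) by apply/val_inj; rewrite /= oE.
move: lk; case: l Il => -[|[|[|//]]] ? _; case: k {nIk} => -[|[|[|//]]] ? //= _;
  by [left|right].
Qed.

(** * Assembling the statements on pairs and on the triple *)

Section main.
Context {d : measure_display} {Omega : measurableType d} {R : realType}.
Variables (P : probability Omega R) (T : R) (T_gt0 : 0 < T).
Variables (n : nat) (B : 'I_n.+1 -> R -> Omega -> R).
Hypothesis B_brownian : brownian_motion P T B.
Variables (e1 e2 : {RV P >-> R}).
Hypotheses (e1_rademacher : rademacher P e1) (e2_rademacher : rademacher P e2).
Hypothesis e1_e2_independent : independent P (sigma_rv e1) (sigma_rv e2).
Hypothesis e12_B_independent : independent P
  (sigma_rv (fun w => (e1 w, e2 w))) (brownian_filtration P T B T).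

Local Notation FB := (brownian_filtration P T B).
Local Notation Z := (future_sign T B).
Local Notation eps := (signals e1 e2 Z).
Local Notation S := (sigma_signals e1 e2 Z).
Local Notation X := (fun w => B ord0 T w - B ord0 (T / 2) w).

Lemma future_sign_values w : Z w \in [:: 0; 1; -1].
Proof. by rewrite /future_sign !inE; case: sgrP; rewrite eqxx ?orbT. Qed.

Lemma immersed_sub_pair (I : set 'I_3) i j : i != j -> I `<=` [set i; j] ->
  independent P (S I) (FB T) /\ immersed P T FB (initial_enlargement P T FB (S I)).
Proof.
move=> ij Iij.
have sFT := usual_augmentation_sigma_algebra P T (natural_filtration B) T.
have mFT : FB T `<=` measurable.
  exact: (brownian_filtration_measurable B_brownian).
have ZFT : sigma_rv Z `<=` FB T by exact: sigma_rv_future_sign.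
have Z0 := future_sign_neq0 T_gt0 B_brownian.
have mE ab : measurable (pair_cell e1 e2 Z i j ab).
  exact: (measurable_pair_cell e1 e2 mFT ZFT).
have PE : (\sum_ab P (pair_cell e1 e2 Z i j ab) = 1)%E.
  by apply: (@sum_probability_pair_cell _ _ _ P (FB T)) => //; exact: future_sign_values.
have indE ab C : FB T C -> (P (pair_cell e1 e2 Z i j ab `&` C) =
    P (pair_cell e1 e2 Z i j ab) * P C)%E.
  by apply: (@pair_cell_independent _ _ _ P (FB T)) => //; exact: future_sign_values.
have tE : trivIset setT (pair_cell e1 e2 Z i j) by exact: trivIset_pair_cell.
have mS : S I `<=` measurable by exact: (sigma_signals_measurable mFT ZFT).
have atomE ab A : S I A -> pair_cell e1 e2 Z i j ab `<=` A \/
    A `&` pair_cell e1 e2 Z i j ab = set0.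
  exact: pair_cell_atom Iij.
have mK := natural_filtration_measurable B_brownian.
split; first exact: (independent_of_cells mK mE tE PE indE mS atomE).
exact: (immersed_of_cells mK mE tE PE indE mS atomE).
Qed.

Lemma prod_signals w : \prod_(i < 3) eps i w = (e1 w ^+ 2 * e2 w ^+ 2) * Z w.
Proof. by rewrite !big_ord_recr big_ord0 /= /signals /=; ring. Qed.

Lemma prod_signals_ae : {ae P, forall w, \prod_(i < 3) eps i w = Z w}.
Proof.
apply: filterS2 (rademacher_ae e1_rademacher) (rademacher_ae e2_rademacher).
by move=> w h1 h2; rewrite prod_signals h1 h2 !mul1r.
Qed.

Lemma triple_not_immersed :
  ~ immersed P T FB (initial_enlargement P T FB (S [set: 'I_3])).
Proof.
(* [A] is defined from the signals alone, so it belongs exactly to their sigma-field; the link with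
   the sign of X is needed only almost surely. *)
pose Q w := \prod_(i < 3) eps i w; pose A := ~` (Q @^-1` [set 1]).
have mFT : FB T `<=` measurable.
  exact: (brownian_filtration_measurable B_brownian).
have ZFT : sigma_rv Z `<=` FB T by exact: sigma_rv_future_sign.
have SA : S [set: 'I_3] A.
  have sS : sigma_algebra setT (S [set: 'I_3]) by exact: smallest_sigma_algebra.
  have mQ : measurable_fun [set: g_sigma_algebraType (S [set: 'I_3])] Q.
    apply: measurable_prod => i _; apply: sigma_rv_measurable_fun => //.
    by move=> D epsD; apply: sub_sigma_algebra; exists i.
  have := mQ measurableT _ (measurable_set1 1).
  rewrite measurable_g_measurableTypeE// => SQ.
  by have [_ SC _] := sS; rewrite /A -setTD -[_ @^-1` _]setTI; exact: SC.
have mA : measurable A by exact: (sigma_signals_measurable mFT ZFT) SA.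
apply: (@not_immersed _ _ _ P T T_gt0 n B B_brownian _ A) => //.
- by move=> u _; apply: sub_sigma_algebra; left; apply: sub_sigma_algebra; right.
- apply: filterS prod_signals_ae => w QZ Aw; rewrite leNgt; apply/negP => X0.
  by apply: Aw; rewrite /= /Q QZ /future_sign gtr0_sg.
- rewrite lt0e measure_ge0 andbT; apply/eqP => PA0.
  have := future_increment_lt0 T_gt0 B_brownian; apply/negP; rewrite -leNgt.
  have [N [mN PN QN]] := prod_signals_ae.
  (* Off the null set [N] the product is [Z], so X < 0 gives product -1 and lands in [A]: were [A]
     null, X < 0 would be null too. *)
  apply: (@le_trans _ _ (P (A `|` N))); last first.
    by have -> : P (A `|` N) = 0%E by rewrite -PA0; exact: measureU0.
  apply: le_measure; rewrite ?inE//; last 2 first.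
    exact: measurableU.
    move=> w /= Xw; apply: contrapT => /not_orP[nA nN]; apply: nN; apply: QN => /= QZ.
    move/contrapT: nA; rewrite /= -/(Q w) /Q QZ /future_sign ltr0_sg// => /eqP.
    by rewrite lt_eqF// (lt_trans (ltrN10 R)).
  have := measurable_future_increment T_gt0 B_brownian measurableT
    (@measurable_itv R `]-oo, 0[).
  by rewrite setTI; congr measurable; apply/seteqP; split=> w /=; rewrite in_itv.
Qed.

End main.
Theorem theorem4p3 (R : realType) (d : measure_display)
    (Omega : measurableType d) (P : probability Omega R)
    (T : R) (T_gt0 : 0 < T)
    (n : nat) (B : 'I_n.+1 -> R -> Omega -> R)
    (B_brownian : brownian_motion P T B)
    (e1 e2 : {RV P >-> R})
    (e1_rademacher : rademacher P e1) (e2_rademacher : rademacher P e2)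
    (e1_e2_independent : independent P (sigma_rv e1) (sigma_rv e2))
    (e12_B_independent :
       independent P (sigma_rv (fun w => (e1 w, e2 w)))
         (brownian_filtration P T B T)) :
  let FB := brownian_filtration P T B in
  let Z := future_sign T B in
  let eps := signals e1 e2 Z in
  let S := sigma_signals e1 e2 Z in
  [/\ sigma_rv Z `<=` FB T,
      forall I : set 'I_3, I `<` [set: 'I_3] ->
        independent P (S I) (FB T) /\
        immersed P T FB (initial_enlargement P T FB (S I)),
      [/\ {ae P, forall w, \prod_(i < 3) eps i w = Z w},
          ~ (exists c : R, {ae P, forall w, Z w = c}) &
          ~ immersed P T FB (initial_enlargement P T FB (S [set: 'I_3]))] &
      [/\ forall i : 'I_3, non_anticipative P T B (S [set i]),
          forall i j : 'I_3, i != j -> non_anticipative P T B (S [set i; j]) &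
          anticipative P T B (S [set: 'I_3])]].
Proof.
have pair := immersed_sub_pair T_gt0 B_brownian e1_rademacher e2_rademacher
  e1_e2_independent e12_B_independent.
have triple := triple_not_immersed T_gt0 B_brownian e1_rademacher e2_rademacher.
move=> FB Z eps S; split.
- exact: sigma_rv_future_sign.
- by move=> I /I3_proper_sub_pair[i [j [ij Iij]]]; exact: pair ij Iij.
- split; [exact: prod_signals_ae|exact: future_sign_not_cst B_brownian|exact: triple].
- split; [|by move=> i j ij; exact: (pair _ _ _ ij _).2|exact: triple].
  move=> i; have [j ij] : exists j : 'I_3, i != j.
    by have [->|] := eqVneq i ord0; [exists ord_max|exists ord0].
  by have [] // := pair [set i] i j ij _; left.
Qed.
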